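(* Let $\mathcal{N}=\{1,\dots,N\}$, and let $f_i:\mathbb{R}^{n_i}\to\overline{\mathbb{R}}$, $Q_i\in\mathbb{R}^{m\times n_i}$ ($i\in\mathcal{N}$), $g:\mathbb{R}^m\to\overline{\mathbb{R}}$ and a graph $\mathcal{G}=(\mathcal{N},\mathcal{E})$ be given. Consider the primal problem $$\text{(P)}\qquad \underset{x_1,\dots,x_N}{\text{minimize}}\quad \sum_{i\in\mathcal{N}} f_i(x_i)+g\Big(\sum_{i\in\mathcal{N}}Q_i x_i\Big),\qquad x_i\in\mathbb{R}^{n_i},$$ and its dual problem $$\text{(D)}\qquad \underset{y\in\mathbb{R}^m}{\text{maximize}}\quad -\sum_{i\in\mathcal{N}}\Big(f_i^{\star}(-Q_i^Ty)+\tfrac1N g^{\star}(y)\Big).$$ Suppose that: 1. $g\in\Gamma_m$ and $f_i\in\Gamma_{n_i}$ for all $i\in\mathcal{N}$; 2. a primal-dual solution of (P), (D) exists and strong duality holds; 3. the graph $\mathcal{G}$ is connected and undirected. Let $\sigma,\rho>0$, and let $(p_i^k,s_i^k,r_i^k,x_i^k,y_i^k,z_i^k)$ be iterates generated by the dual consensus ADMM algorithm (described in the context), with $p_i^0=0$, arbitrary $y_i^0,z_i^0,s_i^0\in\mathbb{R}^m$ and arbitrary initial bounds $M_i>0$, run for infinitely many iterations. Suppose moreover that: 4. for each $i\in\mathcal{N}$ and each $\tilde r_i\in\mathbb{R}^m$ there exist $R>0$ and $\bar M_i$ finite such that, for every $k$, $\|r_i^{k+1}-\tilde r_i\|\le R$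 implies that the solution set of $$\min_{x_i\in\mathbb{R}^{n_i}}\Big\{f_i(x_i)+\tfrac{1}{2(\sigma+2\rho d_i)}\big\|Q_ix_i+r_i^{k+1}\big\|^2\Big\}$$ intersects $\{x_i\in\mathbb{R}^{n_i} : \|x_i\|_\infty\le \bar M_i\}$. Then the iterates $((y_i^k)_{i\in\mathcal{N}})_{k\in\mathbb{N}}$ and $((z_i^k)_{i\in\mathcal{N}})_{k\in\mathbb{N}}$ converge to a maximizer of (D), i.e. there is a maximizer $y^\star$ of (D) such that $y_i^k\to y^\star$ and $z_i^k\to y^\star$ as $k\to\infty$ for every $i\in\mathcal{N}$; and the sequence $((x_i^k)_{i\in\mathcal{N}})_{k\in\mathbb{N}}$ converges to the set of minimizers of (P).
   Context: **Notation.** $\overline{\mathbb{R}}=\mathbb{R}\cup\{+\infty\}$; $\|\cdot\|$ is the Euclidean norm. A function $f:\mathbb{R}^n\to\overline{\mathbb{R}}$ is proper (resp. closed) if its epigraph is nonempty (resp. closed). $\Gamma_n$ is the set of proper, closed and convex functions $f:\mathbb{R}^n\to\overline{\mathbb{R}}$. The conjugate of $f\in\Gamma_n$ is $f^\star(y)=\sup_x\{y^Tx-f(x)\}$. For $\rho>0$, $\mathrm{Prox}_f^{\rho}(x)=\arg\min_y\{f(y)+\frac{\rho}{2}\|x-y\|^2\}$. **Graph.** $\mathcal{E}\subseteq\mathcal{N}\times\mathcal{N}$ is the edge set, $\mathcal{N}_i=\{j\in\mathcal{N} : (i,j)\in\mathcal{E}\}$ is the set of neighbors of $i$, and $d_i=|\mathcal{N}_i|$.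 **Primal-dual solution.** Rewrite (P) as minimizing $\sum_i f_i(x_i)+g(w)$ subject to $\sum_i Q_ix_i=w$. The Lagrangian is $\mathcal{L}(\boldsymbol{x},w,y)=\sum_i f_i(x_i)+g(w)+y^T(\sum_iQ_ix_i-w)$, and (D) is the corresponding Lagrangian dual. A primal-dual solution consists of a minimizer of (P) and a maximizer of (D); strong duality means that the optimal values coincide. **Convergence to a set.** Let $\overline{\mathbb{R}}^n=\mathbb{R}^n\cup\{\infty\}$ denote the extended Euclidean space (one-point compactification of $\mathbb{R}^n$, Riemann sphere). A sequence $(x^k)_{k\in\mathbb{N}}\subseteq\overline{\mathbb{R}}^n$ converges to a set $\mathcal{S}\subseteq\overline{\mathbb{R}}^n$ if for every open neighborhood $V$ of $\mathcal{S}$ in $\overline{\mathbb{R}}^n$ there is a finite $K>0$ such that $k\ge K$ implies $x^k\in V$. Here it is applied to $\boldsymbol{x}^k=(x_1^k,\dots,x_N^k)\in\mathbb{R}^n$ with $n=\sum_i n_i$. **Dual consensus ADMM algorithm.** Parameters $\sigma,\rho>0$; each agent $i$ keeps a bound $M_i>0$, which persists across iterations. At iteration $k=0,1,2,\dots$, for all $i\in\mathcal{N}$: - $p_i^{k+1}=p_i^k+\rho\sum_{j\in\mathcal{N}_i}(y_i^k-y_j^k)$; - $s_i^{k+1}=s_i^k+\sigma(y_i^k-z_i^k)$; - $r_i^{k+1}=\rho\sum_{j\in\mathcal{N}_i}(y_i^k+y_j^k)+\sigma z_i^k-p_i^{k+1}-s_i^{k+1}$; - compute the optimal value $v_i^{k+1}$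 of $\min_{x_i}\{f_i(x_i)+\frac{1}{2(\sigma+2\rho d_i)}\|Q_ix_i+r_i^{k+1}\|^2\}$; - solve the same minimization problem with the added constraint $\|x_i\|_\infty\le M_i$; if this constrained problem is infeasible, or its optimal value is greater than $v_i^{k+1}$, replace $M_i$ by $2M_i$ and repeat this step; otherwise let $x_i^{k+1}$ be any minimizer of the constrained problem; - $y_i^{k+1}=\frac{1}{\sigma+2\rho d_i}\left(Q_ix_i^{k+1}+r_i^{k+1}\right)$; - $z_i^{k+1}=\frac{s_i^{k+1}}{\sigma}+y_i^{k+1}-\frac{1}{N\sigma}\mathrm{Prox}_g^{1/(N\sigma)}\left(N(s_i^{k+1}+\sigma y_i^{k+1})\right)$. *)

(* Defs.v *)
From HB Require Import structures.
From mathcomp Require Export all_boot all_order all_algebra.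
From mathcomp Require Export all_classical all_reals all_analysis.
Set Implicit Arguments.
Unset Strict Implicit.
Unset Printing Implicit Defensive.

Export Order.TTheory GRing.Theory Num.Theory numFieldNormedType.Exports.
#[global] Open Scope classical_set_scope.
#[global] Open Scope ring_scope.

(* The library norm `|x| on 'cV[R]_n is the sup norm (the topology it induces
   is the usual one), so the Euclidean norm has to be defined. *)
Definition enorm (R : realType) (n : nat) (x : 'cV[R]_n) : R :=
  Num.sqrt (\sum_i x i 0 ^+ 2).

Definition epigraph (R : realType) (n : nat) (f : 'cV[R]_n -> \bar R) :
    set ('cV[R]_n * R^o) :=
  [set xt | (f xt.1 <= (xt.2 : R)%:E)%E].

(* Values in R u {+oo} are encoded as values in \bar R other than -oo. *)
Record Gamma (R : realType) (n : nat) (f : 'cV[R]_n -> \bar R) : Prop := {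
  Gamma_neqNy : forall x, f x != -oo%E;
  Gamma_proper : epigraph f !=set0;
  Gamma_closed : closed (epigraph f);
  Gamma_convex : convex_set (epigraph f) }.

Definition argmin (R : realType) (T : Type) (A : set T) (F : T -> \bar R) :
    set T :=
  [set x | A x /\ forall y, A y -> (F x <= F y)%E].

Definition argmax (R : realType) (T : Type) (A : set T) (F : T -> \bar R) :
    set T :=
  [set x | A x /\ forall y, A y -> (F y <= F x)%E].

Definition min_value (R : realType) (T : Type) (A : set T) (F : T -> \bar R) :
    \bar R :=
  ereal_inf (F @` A).

Definition max_value (R : realType) (T : Type) (A : set T) (F : T -> \bar R) :
    \bar R :=
  ereal_sup (F @` A).

Definition conjugate (R : realType) (n : nat) (f : 'cV[R]_n -> \bar R)
    (y : 'cV[R]_n) : \bar R :=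
  ereal_sup (range (fun x => (((y^T *m x) 0 0)%:E - f x)%E)).

Definition prox (R : realType) (n : nat) (rho : R) (f : 'cV[R]_n -> \bar R)
    (x : 'cV[R]_n) : set 'cV[R]_n :=
  argmin setT (fun y => (f y + (rho / 2 * enorm (x - y) ^+ 2)%:E)%E).

Definition primal_obj (R : realType) (N m : nat) (n : 'I_N -> nat)
    (f : forall i, 'cV[R]_(n i) -> \bar R) (Q : forall i, 'M[R]_(m, n i))
    (g : 'cV[R]_m -> \bar R) (x : forall i, 'cV[R]_(n i)) : \bar R :=
  (\sum_i f i (x i) + g (\sum_i Q i *m x i)%R)%E.

Definition dual_obj (R : realType) (N m : nat) (n : 'I_N -> nat)
    (f : forall i, 'cV[R]_(n i) -> \bar R) (Q : forall i, 'M[R]_(m, n i))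
    (g : 'cV[R]_m -> \bar R) (y : 'cV[R]_m) : \bar R :=
  (- \sum_i (conjugate (f i) (- ((Q i)^T *m y))%R
             + (N%:R^-1)%:E * conjugate g y))%E.

Definition neighbors (N : nat) (E : rel 'I_N) (i : 'I_N) : {set 'I_N} :=
  [set j | E i j].

Definition degree (N : nat) (E : rel 'I_N) (i : 'I_N) : nat :=
  #|neighbors E i|.

Definition undirected (N : nat) (E : rel 'I_N) : Prop := symmetric E.

Definition connected_graph (N : nat) (E : rel 'I_N) : Prop :=
  forall i j, connect E i j.

Definition local_obj (R : realType) (m n : nat) (f : 'cV[R]_n -> \bar R)
    (Q : 'M[R]_(m, n)) (sigma rho : R) (d : nat) (r : 'cV[R]_m)
    (x : 'cV[R]_n) : \bar R :=
  (f x + ((2 * (sigma + 2 * rho * d%:R))^-1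
          * enorm (Q *m x + r) ^+ 2)%:E)%E.

(* `|x| is the sup norm here. *)
Definition box (R : realType) (n : nat) (M : R) : set 'cV[R]_n :=
  [set x | `|x| <= M].

(* The problem restricted to the box is feasible and its optimal value is not
   greater than that of the unrestricted problem. *)
Definition acceptable (R : realType) (n : nat) (F : 'cV[R]_n -> \bar R)
    (M : R) : Prop :=
  (exists2 x, box M x & (F x < +oo)%E) /\
  (min_value (box M) F <= min_value setT F)%E.

(* M k i is the bound held by agent i when iteration k starts. Requiring some
   finite number t of doublings says that the doubling loop terminates at every
   iteration. x 0 and r 0 are not constrained. *)
Record dual_consensus_admm (R : realType) (N m : nat) (n : 'I_N -> nat)
    (f : forall i, 'cV[R]_(n i) -> \bar R) (Q : forall i, 'M[R]_(m, n i))
    (g : 'cV[R]_m -> \bar R) (E : rel 'I_N) (sigma rho : R)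
    (p s r y z : nat -> 'I_N -> 'cV[R]_m)
    (x : nat -> forall i, 'cV[R]_(n i)) (M : nat -> 'I_N -> R) : Prop := {
  admm_p : forall k i,
    p k.+1 i = p k i + rho *: \sum_(j in neighbors E i) (y k i - y k j);
  admm_s : forall k i,
    s k.+1 i = s k i + sigma *: (y k i - z k i);
  admm_r : forall k i,
    r k.+1 i = rho *: \sum_(j in neighbors E i) (y k i + y k j)
               + sigma *: z k i - p k.+1 i - s k.+1 i;
  admm_M : forall k i,
    let F := local_obj (f i) (Q i) sigma rho (degree E i) (r k.+1 i) in
    exists t : nat,
      [/\ M k.+1 i = 2 ^+ t * M k i,
          acceptable F (M k.+1 i) &
          forall t', (t' < t)%N -> ~ acceptable F (2 ^+ t' * M k i)];
  admm_x : forall k i,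
    argmin (box (M k.+1 i))
      (local_obj (f i) (Q i) sigma rho (degree E i) (r k.+1 i)) (x k.+1 i);
  admm_y : forall k i,
    y k.+1 i = (sigma + 2 * rho * (degree E i)%:R)^-1
               *: (Q i *m x k.+1 i + r k.+1 i);
  admm_z : forall k i,
    exists2 q,
      prox (N%:R * sigma)^-1 g (N%:R *: (s k.+1 i + sigma *: y k.+1 i)) q &
      z k.+1 i = sigma^-1 *: s k.+1 i + y k.+1 i - (N%:R * sigma)^-1 *: q }.

Definition cvg_to_set (T : topologicalType) (u : nat -> T) (S : set T) : Prop :=
  forall V : set T, open V -> S `<=` V -> \forall k \near \oo, V (u k).

Definition stack (R : realType) (N : nat) (n : 'I_N -> nat)
    (x : forall i, 'cV[R]_(n i)) : 'cV[R]_(\sum_i n i) :=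
  \mxcol_i x i.

Definition to_opc (X : topologicalType) (x : X) :
    one_point_compactification X :=
  Some x.

(* Main.v *)
Require Import Defs.
From mathcomp Require Import ring lra.
Set Implicit Arguments.
Unset Strict Implicit.
Unset Printing Implicit Defensive.

(* Write L and A for the Laplacian and the signless Laplacian of the graph, and
   stack the vectors of the agents as the columns of matrices. Eliminating r,
   the iteration reads
     - Q_i^T y_i in df_i(x_i),  z_i in dg(N s_i'),
     Q x' = rho (y' - y) A + p'' + s'' + sigma (z' - z),
     p'' = p' + rho y' L,  s'' = s' + sigma (y' - z'),
   so monotonicity of the subdifferentials makes
     rho |y - y0|_A^2 + |p' - p0|_{L^+}^2 / rho + |s' - s0|^2 / sigma
       + sigma |z - y0|^2
   decrease by at least the squared consensus residuals, for every saddle point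
   x0, y0 with Q_i x0_i = p0_i + s0_i and sum_i p0_i = 0. Hence the residuals
   vanish and y, z, p, s are bounded; local boundedness of the subproblem
   solutions then bounds the M_i, hence x. Limits along ultrafilters replace
   convergent subsequences: each of them is again a saddle point, and the
   Lyapunov function relative to it tends to 0. *)

(** * Euclidean structure and limits of matrices *)

Section inner_product.
Context {R : realType}.

(** The Frobenius inner product; on columns it is the Euclidean one. *)
Definition mxdot (m n : nat) (A B : 'M[R]_(m, n)) : R := \tr (A^T *m B).

Lemma mxdotE (m n : nat) (A B : 'M[R]_(m, n)) :
  mxdot A B = \sum_j \sum_i A i j * B i j.
Proof.
by apply: eq_bigr => j _; rewrite mxE; apply: eq_bigr => i _; rewrite mxE.
Qed.

Lemma mxdotC (m n : nat) (A B : 'M[R]_(m, n)) : mxdot A B = mxdot B A.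
Proof. by rewrite /mxdot -mxtrace_tr trmx_mul trmxK. Qed.

Lemma mxdotDr (m n : nat) (A B C : 'M[R]_(m, n)) :
  mxdot A (B + C) = mxdot A B + mxdot A C.
Proof. by rewrite /mxdot mulmxDr raddfD. Qed.

Lemma mxdotDl (m n : nat) (A B C : 'M[R]_(m, n)) :
  mxdot (A + B) C = mxdot A C + mxdot B C.
Proof. by rewrite !(mxdotC _ C) mxdotDr. Qed.

Lemma mxdotNr (m n : nat) (A B : 'M[R]_(m, n)) : mxdot A (- B) = - mxdot A B.
Proof. by rewrite /mxdot mulmxN raddfN. Qed.

Lemma mxdotNl (m n : nat) (A B : 'M[R]_(m, n)) : mxdot (- A) B = - mxdot A B.
Proof. by rewrite mxdotC mxdotNr mxdotC. Qed.

Lemma mxdotZr (m n : nat) a (A B : 'M[R]_(m, n)) :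
  mxdot A (a *: B) = a * mxdot A B.
Proof. by rewrite /mxdot -scalemxAr mxtraceZ. Qed.

Lemma mxdotZl (m n : nat) a (A B : 'M[R]_(m, n)) :
  mxdot (a *: A) B = a * mxdot A B.
Proof. by rewrite mxdotC mxdotZr mxdotC. Qed.

Lemma mxdot0r (m n : nat) (A : 'M[R]_(m, n)) : mxdot A 0 = 0.
Proof. by rewrite /mxdot mulmx0 mxtrace0. Qed.

Definition mxdot_lin :=
  (mxdotDr, mxdotDl, mxdotNr, mxdotNl, mxdotZr, mxdotZl).

Lemma mxdot_sumr (m n : nat) (I : finType) (A : 'M[R]_(m, n))
    (B : I -> 'M[R]_(m, n)) :
  mxdot A (\sum_i B i) = \sum_i mxdot A (B i).
Proof. by rewrite /mxdot mulmx_sumr raddf_sum. Qed.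

Lemma mxdot_mull (m n l : nat) (M : 'M[R]_(m, l)) (A : 'M[R]_(l, n)) B :
  mxdot (M *m A) B = mxdot A (M^T *m B).
Proof. by rewrite /mxdot trmx_mul -mulmxA. Qed.

Lemma mxdot_mulr (m n l : nat) (A : 'M[R]_(m, l)) (M : 'M[R]_(l, n)) B :
  mxdot (A *m M) B = mxdot A (B *m M^T).
Proof. by rewrite /mxdot trmx_mul mxtrace_mulC mulmxA mxtrace_mulC mulmxA. Qed.

Lemma mxdot_col (m n : nat) (A B : 'M[R]_(m, n)) :
  mxdot A B = \sum_j mxdot (col j A) (col j B).
Proof.
rewrite mxdotE; apply: eq_bigr => j _; rewrite mxdotE big_ord1.
by apply: eq_bigr => i _; rewrite !mxE.
Qed.

Lemma mxdot_ge0 (m n : nat) (A : 'M[R]_(m, n)) : 0 <= mxdot A A.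
Proof.
rewrite mxdotE; apply: sumr_ge0 => j _; apply: sumr_ge0 => i _.
by rewrite -expr2 sqr_ge0.
Qed.

Lemma sqr_entry_le_mxdot (m n : nat) (A : 'M[R]_(m, n)) i j :
  A i j ^+ 2 <= mxdot A A.
Proof.
rewrite mxdotE (bigD1 j)//= (bigD1 i)//= -expr2 -addrA lerDl.
apply: addr_ge0; first by apply: sumr_ge0 => k _; rewrite -expr2 sqr_ge0.
by apply: sumr_ge0 => k _; apply: sumr_ge0 => l _; rewrite -expr2 sqr_ge0.
Qed.

Lemma trmx_mul00 (n : nat) (u v : 'cV[R]_n) : (u^T *m v) 0 0 = mxdot u v.
Proof. by rewrite /mxdot /mxtrace big_ord1. Qed.

Lemma sqr_enorm (n : nat) (u : 'cV[R]_n) : enorm u ^+ 2 = mxdot u u.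
Proof.
rewrite /enorm sqr_sqrtr; last by apply: sumr_ge0 => i _; exact: sqr_ge0.
by rewrite mxdotE big_ord1; apply: eq_bigr => i _; rewrite expr2.
Qed.

End inner_product.

Lemma ler_mxnorm_entry (R : realType) (m n : nat) (A : 'M[R]_(m, n)) i j :
  `|A i j| <= `|A|.
Proof.
rewrite [leRHS]/Num.norm /= mx_normrE.
exact: (le_bigmax _ (fun ij => `|A ij.1 ij.2|) (i, j)).
Qed.

(** * Entrywise limits of matrices along a filter *)

Section matrix_limits.
Context {R : realType} {T : Type} {F : set_system T} {FF : Filter F}.

Lemma cvg_sumr (V : normedModType R) (I : Type) (r : seq I) (P : pred I)
    (f : I -> T -> V) (l : I -> V) :
  (forall i, P i -> f i @ F --> l i) ->
  (fun t => \sum_(i <- r | P i) f i t) @ F --> \sum_(i <- r | P i) l i.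
Proof.
move=> fl; elim: r => [|i r IH].
  by rewrite big_nil; under eq_fun do rewrite big_nil; exact: cvg_cst.
rewrite big_cons; under eq_fun do rewrite big_cons.
by case: ifP => // Pi; apply: cvgD => //; exact: fl.
Qed.

Lemma mx_cvgP (m n : nat) (u : T -> 'M[R]_(m, n)) (l : 'M[R]_(m, n)) :
  u @ F --> l <-> forall i j, (fun t => u t i j) @ F --> l i j.
Proof.
split=> [ul i j | uij A [P lP PA]].
  exact: (cvg_comp _ _ ul (@coord_continuous _ _ _ i j l)).
rewrite /= /fmap /nbhs /=.
apply: (@filterS _ F FF (fun t => forall i j, P i j (u t i j))).
  by move=> t Pt; apply: PA.
by apply: filter_forall => i; apply: filter_forall => j; exact: uij.
Qed.

Lemma cvg_mulmx (m n l : nat) (M : 'M[R]_(m, n)) (u : T -> 'M[R]_(n, l))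
    (a : 'M[R]_(n, l)) :
  u @ F --> a -> (fun t => M *m u t) @ F --> M *m a.
Proof.
move=> /mx_cvgP ua; apply/mx_cvgP => i j.
rewrite mxE; under eq_fun do rewrite mxE.
by apply: cvg_sumr => k _; apply: cvgM; [exact: cvg_cst|exact: ua].
Qed.

Lemma cvg_mulmxr (m n l : nat) (M : 'M[R]_(n, l)) (u : T -> 'M[R]_(m, n))
    (a : 'M[R]_(m, n)) :
  u @ F --> a -> (fun t => u t *m M) @ F --> a *m M.
Proof.
move=> /mx_cvgP ua; apply/mx_cvgP => i j.
rewrite mxE; under eq_fun do rewrite mxE.
by apply: cvg_sumr => k _; apply: cvgM; [exact: ua|exact: cvg_cst].
Qed.

Lemma cvg_mxdot (m n : nat) (u v : T -> 'M[R]_(m, n)) (a b : 'M[R]_(m, n)) :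
  u @ F --> a -> v @ F --> b -> (fun t => mxdot (u t) (v t)) @ F --> mxdot a b.
Proof.
move=> /mx_cvgP ua /mx_cvgP vb.
rewrite mxdotE; under eq_fun do rewrite mxdotE.
by apply: cvg_sumr => j _; apply: cvg_sumr => i _; apply: cvgM.
Qed.

Lemma cvg_col (m n : nat) (u : T -> 'M[R]_(m, n)) (a : 'M[R]_(m, n)) j :
  u @ F --> a -> (fun t => col j (u t)) @ F --> col j a.
Proof.
move=> /mx_cvgP ua; apply/mx_cvgP => i k.
by rewrite mxE; under eq_fun do rewrite mxE; exact: ua.
Qed.

Lemma mxdot_cvg0 (m n : nat) (u : T -> 'M[R]_(m, n)) :
  (fun t => mxdot (u t) (u t)) @ F --> (0 : R) -> u @ F --> (0 : 'M[R]_(m, n)).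
Proof.
move=> u0; apply/mx_cvgP => i j; rewrite mxE.
apply/cvgr0Pnorm_lt => e e0.
have e20 : 0 < e ^+ 2 by rewrite exprn_gt0.
move/cvgr0Pnorm_lt : u0 => /(_ _ e20); apply: filterS => t /= lt.
rewrite -(@ltr_pXn2r _ 2)// ?nnegrE ?ltW// real_normK ?num_real//.
by apply: le_lt_trans lt; rewrite ger0_norm ?mxdot_ge0 ?sqr_entry_le_mxdot.
Qed.

End matrix_limits.

(** * Limits of bounded matrices along ultrafilters *)

Section ultrafilter_limits.
Context {R : realType} {T : Type} {U : set_system T} {UU : UltraFilter U}.

(** The image of an ultrafilter is an ultrafilter, and one that contains a compact segment
    converges. Applied to each entry, this stands in for extracting subsequences. *)
Lemma ultra_bounded_cvg (m n : nat) (u : T -> 'M[R]_(m, n)) (B : R) :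
  (forall i j, \forall t \near U, `|u t i j| <= B) ->
  exists l : 'M[R]_(m, n), u @ U --> l.
Proof.
move=> uB.
suff h i j : exists l : R, (fun t => u t i j) @ U --> l.
  exists (\matrix_(i, j) sval (cid (h i j))); apply/mx_cvgP => i j.
  by rewrite mxE; exact: (svalP (cid (h i j))).
have := @segment_compact R (- B) B.
rewrite compact_ultra => /(_ ((fun t => u t i j) @ U)); case.
- split; first exact: fmap_proper_filter.
  move=> G GF le; apply/seteqP; split=> // A GA.
  have [//|UnA] := @in_ultra_setVsetC _ U ((fun t => u t i j) @^-1` A) UU.
  have GnA : G (~` A) by apply: le.
  by have [x []] := filter_ex (filterI GA GnA).
- by apply: filterS (uB i j) => t; rewrite /= in_itv /= ler_norml.
- by move=> l [_ cl]; exists l.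
Qed.

End ultrafilter_limits.

(** * Subgradients and optimality conditions *)

Section subgradients.
Context {R : realType}.

Definition subgradient (n : nat) (f : 'cV[R]_n -> \bar R) (x v : 'cV[R]_n) :=
  forall x', (f x + (mxdot v (x' - x))%:E <= f x')%E.

Lemma ereal_finite (e : \bar R) (b : R) :
  e != -oo%E -> (e <= b%:E)%E -> exists a, e = a%:E.
Proof. by case: e => [a| |] // _ _; exists a. Qed.

Lemma Gamma_finite (n : nat) (f : 'cV[R]_n -> \bar R) :
  Gamma f -> exists x a, f x = a%:E.
Proof.
case=> fNy [[x a] /= fxa] _ _; exists x.
exact: ereal_finite (fNy x) fxa.
Qed.

(** A proper function is finite somewhere, and the subgradient inequality tested at such a point
    rules out the value [+oo] at [x]. *)
Lemma subgradient_finite (n : nat) (f : 'cV[R]_n -> \bar R) x v :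
  Gamma f -> subgradient f x v -> exists a, f x = a%:E.
Proof.
move=> fG fv; have [x0 [a fx0]] := Gamma_finite fG.
have := fv x0; rewrite fx0 -leeBrDr// -EFinB.
exact/ereal_finite/(Gamma_neqNy fG x).
Qed.

Lemma subgradient_monotone (n : nat) (f : 'cV[R]_n -> \bar R) x v x' v' :
  Gamma f -> subgradient f x v -> subgradient f x' v' ->
  0 <= mxdot (v - v') (x - x').
Proof.
move=> fG fv fv'.
have [a fa] := subgradient_finite fG fv.
have [b fb] := subgradient_finite fG fv'.
have := fv x'; have := fv' x; rewrite fa fb -!EFinD !lee_fin !mxdot_lin.
lra.
Qed.

Lemma epigraph_conv (n : nat) (f : 'cV[R]_n -> \bar R) x a y b (t : R) :
  Gamma f -> (f x <= a%:E)%E -> (f y <= b%:E)%E -> 0 <= t <= 1 ->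
  (f (t *: x + (1 - t) *: y)%R <= (t * a + (1 - t) * b)%:E)%E.
Proof.
move=> /Gamma_convex fc fx fy /andP[t0 t1].
have := fc (x, a) (y, b) (Itv01 t0 t1).
rewrite !inE => h. exact: h.
Qed.

(** Extracts a first-order condition from a comparison along a segment. *)
Lemma ge0_of_small_quadratic (a b : R) :
  (forall t, 0 < t <= 1 -> 0 <= t * a + t ^+ 2 * b) -> 0 <= a.
Proof.
move=> h; rewrite leNgt; apply/negP => a0.
(* For negative [a], this [t] is so small that the quadratic term offsets at most half of the linear
   one; adding 1 keeps the denominator positive when [b] is 0. *)
pose t := Num.min 1 (- a / (2 * (`|b| + 1))).
have b1 : 0 < `|b| + 1 by rewrite ltr_wpDl.
have t0 : 0 < t by rewrite lt_min ltr01/= divr_gt0 ?oppr_gt0// mulr_gt0.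
have t1 : t <= 1 by rewrite ge_min lexx.
have tb : t * (2 * (`|b| + 1)) <= - a.
  by rewrite -ler_pdivlMr ?mulr_gt0// ge_min lexx orbT.
have := h t; rewrite t0 t1 => /(_ isT).
rewrite expr2 -mulrA -mulrDr pmulr_rge0// => ge.
have bb : t * b <= t * `|b| by rewrite ler_pM2l// ler_norm.
have : 0 <= t * `|b| by rewrite mulr_ge0// ltW.
lra.
Qed.

(** Fermat's rule for a convex function plus a quadratic: compare [x] with the points of the segment
    towards any [x']. It serves both the local problems and the proximal step. *)
Lemma argmin_subgradient (m n : nat) (f : 'cV[R]_n -> \bar R)
    (A : 'M[R]_(m, n)) (r : 'cV[R]_m) (c : R) x :
  Gamma f -> 0 < c ->
  argmin setT
    (fun x => (f x + ((2 * c)^-1 * enorm (A *m x + r) ^+ 2)%:E)%E) x ->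
  subgradient f x (- (A^T *m (c^-1 *: (A *m x + r)))).
Proof.
move=> fG c0 [_ xmin].
have [a fa] : exists a, f x = a%:E.
  have [x0 [a fx0]] := Gamma_finite fG.
  have := xmin x0 I; rewrite fx0 -EFinD -leeBrDr// -EFinB.
  exact/ereal_finite/(Gamma_neqNy fG x).
move=> x'; case fb : (f x') => [b| |]; last 2 first.
- by rewrite leey.
- by move: (Gamma_neqNy fG x'); rewrite fb.
rewrite fa -EFinD lee_fin.
set w := A *m x + r; set d := x' - x.
suff ge0 : 0 <= (b - a) + c^-1 * mxdot w (A *m d).
  by rewrite mxdotNl mxdot_mull trmxK mxdotZl; move: ge0; set u := c^-1 * _; lra.
apply: (@ge0_of_small_quadratic _ ((2 * c)^-1 * mxdot (A *m d) (A *m d))).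
move=> t /andP[t0 t1].
have t01 : 0 <= t <= 1 by rewrite t1 ltW.
have fz : (f (t *: x' + (1 - t) *: x)%R <= (t * b + (1 - t) * a)%:E)%E.
  by apply: epigraph_conv => //; rewrite ?fa ?fb.
have := le_trans (xmin _ I) (leeD2r _ fz).
have -> : A *m (t *: x' + (1 - t) *: x) + r = w + t *: (A *m d).
  rewrite /w /d mulmxDr -!scalemxAr mulmxBr.
  by move: (A *m x) (A *m x') => p q; apply/matrixP => i j; rewrite !mxE; ring.
rewrite fa -!EFinD lee_fin !sqr_enorm -/w; clearbody w; rewrite !mxdot_lin.
have -> : (2 * c)^-1 = 2^-1 * c^-1 by rewrite invfM.
rewrite (mxdotC (A *m d) w).
lra.
Qed.
End subgradients.

Section optimality.
Context {R : realType}.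

(** For fixed [w] with [f w = a], the subgradient inequality says that [(x, a - <v, w - x>)] lies in
    the epigraph, whose closedness carries it to the limit. *)
Lemma subgradient_closed (T : Type) (F : set_system T) {FF : ProperFilter F}
    (n : nat) (f : 'cV[R]_n -> \bar R) (x v : T -> 'cV[R]_n)
    (x' v' : 'cV[R]_n) :
  Gamma f -> (\forall t \near F, subgradient f (x t) (v t)) ->
  x @ F --> x' -> v @ F --> v' -> subgradient f x' v'.
Proof.
move=> fG fv cx cv w; case fa : (f w) => [a| |]; last 2 first.
- by rewrite leey.
- by move: (Gamma_neqNy fG w); rewrite fa.
pose u t : 'cV[R]_n * R^o := (x t, a - mxdot (v t) (w - x t)).
have : epigraph f (x', a - mxdot v' (w - x')).
  apply: (@closed_cvg _ _ F FF u _ (Gamma_closed fG)).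
    by apply: filterS fv => t /(_ w); rewrite fa /epigraph /= -leeBrDr.
  have cu : (fun t => a - mxdot (v t) (w - x t)) @ F --> a - mxdot v' (w - x').
    apply: cvgB; first exact: cvg_cst.
    by apply: cvg_mxdot => //; apply: cvgB => //; exact: cvg_cst.
  exact: cvg_pair cx cu.
by rewrite /epigraph /= -leeBrDr.
Qed.

Lemma epigraph_mean (n : nat) (f : 'cV[R]_n -> \bar R) (N : nat)
    (x : nat -> 'cV[R]_n) (a : nat -> R) :
  Gamma f -> (forall i, (f (x i) <= (a i)%:E)%E) ->
  (f (N.+1%:R^-1 *: \sum_(i < N.+1) x i)%R
     <= (N.+1%:R^-1 * \sum_(i < N.+1) a i)%:E)%E.
Proof.
move=> fG fxa; elim: N => [|N IH]; first by rewrite !big_ord1 invr1 scale1r mul1r.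
rewrite !(big_ord_recr N.+1) /=.
set X := \sum_(i < N.+1) x i in IH *; set A := \sum_(i < N.+1) a i in IH *.
have N1 : (N.+1%:R : R) != 0 by rewrite pnatr_eq0.
have N2 : (N.+2%:R : R) != 0 by rewrite pnatr_eq0.
(* The weight of the mean of the first [N.+1] points in the mean of all [N.+2]. *)
pose t : R := N.+1%:R / N.+2%:R.
have t1 : 1 - t = N.+2%:R^-1.
  by rewrite /t -{1}(divff N2) -mulrBl -natrB// subSnn mul1r.
have tN : t * N.+1%:R^-1 = N.+2%:R^-1 by rewrite /t mulrAC divff// mul1r.
have t01 : 0 <= t <= 1.
  by rewrite divr_ge0//= -subr_ge0 t1 invr_ge0.
have := epigraph_conv fG IH (fxa N.+1) t01.
by rewrite t1 scalerA mulrA tN -scalerDr -mulrDr.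
Qed.

(** The points at which a given [v] is a subgradient form a convex set, and [\sum_i x i] is the mean
    of the points [N%:R *: x i]. *)
Lemma subgradient_mean (n : nat) (f : 'cV[R]_n -> \bar R) (N : nat)
    (x : 'I_N -> 'cV[R]_n) (v : 'cV[R]_n) :
  (0 < N)%N -> Gamma f -> (forall i, subgradient f (N%:R *: x i) v) ->
  subgradient f (\sum_i x i) v.
Proof.
case: N x => // N x _ fG fv w; case fa : (f w) => [a| |]; last 2 first.
- by rewrite leey.
- by move: (Gamma_neqNy fG w); rewrite fa.
have N1 : (N.+1%:R : R) != 0 by rewrite pnatr_eq0.
pose X i := N.+1%:R *: x (inord i); pose A i := a - mxdot v (w - X i).
have := @epigraph_mean n f N X A fG.
have -> : N.+1%:R^-1 *: \sum_(i < N.+1) X i = \sum_i x i.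
  rewrite /X -scaler_sumr scalerA mulVf// scale1r.
  by apply: eq_bigr => i _; rewrite inord_val.
have -> : N.+1%:R^-1 * \sum_(i < N.+1) A i = a - mxdot v (w - \sum_i x i).
  rewrite /A sumrB sumr_const card_ord -mxdot_sumr sumrB sumr_const card_ord.
  rewrite /X -scaler_sumr.
  have -> : \sum_(i < N.+1) x (inord i) = \sum_i x i.
    by apply: eq_bigr => i _; rewrite inord_val.
  rewrite -(scaler_nat _ w) -scalerBr mxdotZr mulrBr -(mulr_natl a) mulKf// mulKf//.
move=> h; rewrite -leeBrDr// -EFinB; apply: h => i.
by have := fv (inord i) w; rewrite fa -leeBrDr.
Qed.

(** * Conjugates, the Fenchel-Young inequality and the optimality system *)

Lemma conjugate_subgradient (l : nat) (h : 'cV[R]_l -> \bar R) x v a :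
  h x = a%:E -> subgradient h x v -> conjugate h v = (mxdot v x - a)%:E.
Proof.
move=> ha hv; apply/eqP; rewrite eq_le; apply/andP; split.
  apply: ge_ereal_sup => _ [w _ <-]; rewrite trmx_mul00.
  have := hv w; rewrite ha -EFinD mxdotDr mxdotNr.
  case: (h w) => [b| |]//=; last by rewrite leNye.
  rewrite !lee_fin; lra.
by apply: ereal_sup_ubound; exists x => //; rewrite trmx_mul00 ha.
Qed.

Lemma fenchel_young (l : nat) (h : 'cV[R]_l -> \bar R) x v a :
  h x = a%:E -> ((mxdot v x - a)%:E <= conjugate h v)%E.
Proof.
by move=> ha; apply: ereal_sup_ubound; exists x => //; rewrite trmx_mul00 ha.
Qed.

(** Equality in Fenchel-Young means that [x] attains the supremum defining the conjugate, which is
    the subgradient inequality rearranged. *)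
Lemma subgradient_conjugate (l : nat) (h : 'cV[R]_l -> \bar R) x v a :
  (forall w, h w != -oo%E) ->
  h x = a%:E -> conjugate h v = (mxdot v x - a)%:E -> subgradient h x v.
Proof.
move=> hNy ha hv w; rewrite ha.
have : (((v^T *m w) 0 0)%:E - h w <= conjugate h v)%E.
  by apply: ereal_sup_ubound; exists w.
rewrite hv trmx_mul00; move: (hNy w); case: (h w) => [b| |]//= _.
  rewrite -EFinD !lee_fin mxdotDr mxdotNr; lra.
by move=> _; rewrite leey.
Qed.

Definition kkt (N m : nat) (n : 'I_N -> nat)
    (f : forall i, 'cV[R]_(n i) -> \bar R) (Q : forall i, 'M[R]_(m, n i))
    (g : 'cV[R]_m -> \bar R) (x : forall i, 'cV[R]_(n i)) (y : 'cV[R]_m) :=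
  (forall i, subgradient (f i) (x i) (- ((Q i)^T *m y))) /\
  subgradient g (\sum_i Q i *m x i) y.

Lemma sum_mxdot_adjoint (N m : nat) (n : 'I_N -> nat)
    (Q : forall i, 'M[R]_(m, n i)) (x : forall i, 'cV[R]_(n i)) y :
  \sum_i mxdot (- ((Q i)^T *m y)) (x i) = - mxdot y (\sum_i Q i *m x i).
Proof.
rewrite mxdot_sumr -sumrN; apply: eq_bigr => i _.
by rewrite mxdotNl mxdot_mull trmxK.
Qed.

(** Add the subgradient inequalities at a competitor [w]: the linear terms of the [f i] and of [g]
    cancel. *)
Lemma kkt_argmin (N m : nat) (n : 'I_N -> nat)
    (f : forall i, 'cV[R]_(n i) -> \bar R) (Q : forall i, 'M[R]_(m, n i))
    (g : 'cV[R]_m -> \bar R) x y :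
  (forall i, Gamma (f i)) -> Gamma g -> kkt f Q g x y ->
  argmin setT (primal_obj f Q g) x.
Proof.
move=> fG gG [fx gx]; split => // w _; rewrite /primal_obj.
have fin i : {a | f i (x i) = a%:E}.
  by apply: cid; exact: subgradient_finite (fG i) (fx i).
pose a i := sval (fin i); have aE i : f i (x i) = (a i)%:E := svalP (fin i).
have [b bE] := subgradient_finite gG gx.
have fle : (\sum_i f i (x i)
    + (mxdot y (- \sum_i Q i *m (w i - x i)))%:E <= \sum_i f i (w i))%E.
  rewrite mxdotNr -sum_mxdot_adjoint -sumEFin -[X in (X <= _)%E]big_split/=.
  by apply: lee_sum => i _; exact: fx.
have gle : (g (\sum_i Q i *m x i)%R + (mxdot y (\sum_i Q i *m (w i - x i)))%:E
    <= g (\sum_i Q i *m w i)%R)%E.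
  have -> : \sum_i Q i *m (w i - x i) = \sum_i Q i *m w i - \sum_i Q i *m x i.
    by rewrite -sumrB; apply: eq_bigr => i _; rewrite mulmxBr.
  exact: gx.
have := leeD fle gle.
under [in X in (X <= _)%E -> _]eq_bigr do rewrite aE.
under [in X in _ -> (X <= _)%E]eq_bigr do rewrite aE.
rewrite bE sumEFin -!EFinD mxdotNr.
set d := mxdot _ _; set A := \sum_i a i.
by have -> : A - d + (b + d) = A + b by ring.
Qed.

(** Fenchel-Young is an equality in every term; the pairings cancel, and the [N] equal shares of the
    conjugate of [g] add up to one. *)
Lemma kkt_dual_obj (N m : nat) (n : 'I_N -> nat)
    (f : forall i, 'cV[R]_(n i) -> \bar R) (Q : forall i, 'M[R]_(m, n i))
    (g : 'cV[R]_m -> \bar R) x y :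
  (0 < N)%N -> (forall i, Gamma (f i)) -> Gamma g -> kkt f Q g x y ->
  dual_obj f Q g y = primal_obj f Q g x.
Proof.
move=> N0 fG gG [fx gx]; rewrite /primal_obj /dual_obj.
have fin i : {a | f i (x i) = a%:E}.
  by apply: cid; exact: subgradient_finite (fG i) (fx i).
pose a i := sval (fin i); have aE i : f i (x i) = (a i)%:E := svalP (fin i).
have [b bE] := subgradient_finite gG gx.
under eq_bigr => i _.
  rewrite (conjugate_subgradient (aE i) (fx i)) (conjugate_subgradient bE gx).
  rewrite -EFinM -EFinD; over.
under [in RHS]eq_bigr do rewrite aE.
rewrite bE !sumEFin -EFinN -EFinD; congr EFin.
rewrite big_split/= sumr_const card_ord.
rewrite -(mulr_natl (N%:R^-1 * _)) mulVKf ?pnatr_eq0 -?lt0n//.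
rewrite sumrB sum_mxdot_adjoint; ring.
Qed.

(** The duality gap is a sum of nonnegative Fenchel-Young slacks, so a zero gap makes each slack
    zero, and equality in Fenchel-Young gives the subgradients. *)
Lemma optimal_kkt (N m : nat) (n : 'I_N -> nat)
    (f : forall i, 'cV[R]_(n i) -> \bar R) (Q : forall i, 'M[R]_(m, n i))
    (g : 'cV[R]_m -> \bar R) x y :
  (0 < N)%N -> (forall i, Gamma (f i)) -> Gamma g ->
  dual_obj f Q g y = primal_obj f Q g x -> kkt f Q g x y.
Proof.
move=> N0 fG gG.
have N1 : (N%:R : R) != 0 by rewrite pnatr_eq0 -lt0n.
have conjNy (l : nat) (h : 'cV[R]_l -> \bar R) v :
    Gamma h -> conjugate h v != -oo%E.
  move=> /Gamma_finite[w [c cE]]; have := fenchel_young v cE.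
  by case: conjugate.
set F := fun i => conjugate (f i) (- ((Q i)^T *m y)).
set G := conjugate g y.
have FNy i : F i != -oo%E by exact: conjNy.
have GNy : G != -oo%E by exact: conjNy.
have NGNy : ((N%:R^-1)%:E * G)%E != -oo%E.
  move: GNy; case: (G) => [c| |]// _.
  by rewrite gt0_muley// lte_fin invr_gt0 ltr0n.
have sumNy (H : 'I_N -> \bar R) : (forall i, H i != -oo%E) ->
    (\sum_i H i)%E != -oo%E.
  by move=> HNy; rewrite esum_eqNy; apply/existsPn => i; exact: HNy.
rewrite /dual_obj /primal_obj -/F -/G => eq.
have PNy : (\sum_i f i (x i) + g (\sum_i Q i *m x i)%R)%E != -oo%E.
  rewrite adde_eq_ninfty negb_or (Gamma_neqNy gG) andbT.
  by apply: sumNy => i; exact: Gamma_neqNy.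
have DNy : (\sum_i (F i + (N%:R^-1)%:E * G))%E != -oo%E.
  by apply: sumNy => i; rewrite adde_eq_ninfty negb_or FNy.
(* The common value is finite: the primal one is never [-oo], the dual one never [+oo]. *)
have Dfin : (\sum_i (F i + (N%:R^-1)%:E * G))%E \is a fin_num.
  rewrite fin_numE DNy /=; apply/eqP => Dy.
  by move: PNy; rewrite -eq Dy.
have Pfin : (\sum_i f i (x i) + g (\sum_i Q i *m x i)%R)%E \is a fin_num.
  by rewrite -eq fin_numN.
move: (Pfin); rewrite fin_numD => /andP[/sum_fin_numP ffin gfin].
have {}ffin i : f i (x i) = (fine (f i (x i)))%:E.
  by rewrite fineK// ffin ?mem_index_enum.
move/sum_fin_numP : Dfin => FGfin.
have Ffin i : F i = (fine (F i))%:E.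
  have := FGfin i (mem_index_enum _) isT.
  by rewrite fin_numD => /andP[? _]; rewrite fineK.
(* The conjugate of [g] occurs only inside the sum over agents, so its finiteness is read off at one
   agent, which exists since [N] is positive. *)
have Gfin : G = (fine G)%:E.
  have := FGfin (Ordinal N0) (mem_index_enum _) isT.
  rewrite fin_numD => /andP[_]; move: GNy; case: (G) => [c| |]// _.
  by rewrite gt0_muley// lte_fin invr_gt0 ltr0n.
have gE : g (\sum_i Q i *m x i) = (fine (g (\sum_i Q i *m x i)))%:E by rewrite fineK.
pose a i := fine (f i (x i)); pose b := fine (g (\sum_i Q i *m x i)).
have FYf i : mxdot (- ((Q i)^T *m y)) (x i) - a i <= fine (F i).
  by rewrite -lee_fin -Ffin; exact: fenchel_young.
have FYg : mxdot y (\sum_i Q i *m x i) - b <= fine G.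
  by rewrite -lee_fin -Gfin; exact: fenchel_young.
(* The total slack is the primal value minus the dual value. *)
have tot : \sum_i (fine (F i) - (mxdot (- ((Q i)^T *m y)) (x i) - a i)) +
    (fine G - (mxdot y (\sum_i Q i *m x i) - b)) = 0.
  have eD : (\sum_i (F i + (N%:R^-1)%:E * G))%E =
      (\sum_i (fine (F i) + N%:R^-1 * fine G))%:E.
    rewrite -sumEFin; apply: eq_bigr => i _.
    by rewrite [in LHS]Ffin [in LHS]Gfin -EFinM -EFinD.
  have eP : (\sum_i f i (x i))%E = (\sum_i a i)%:E.
    by rewrite -sumEFin; apply: eq_bigr => i _; rewrite [in LHS]ffin.
  move: eq; rewrite eD eP gE -EFinN -EFinD => -[].
  rewrite big_split/= sumr_const card_ord -(mulr_natl (N%:R^-1 * _)) mulVKf// => eq.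
  rewrite !sumrB sum_mxdot_adjoint; move: eq; rewrite -/b; lra.
have slack_ge0 i : 0 <= fine (F i) - (mxdot (- ((Q i)^T *m y)) (x i) - a i).
  by rewrite subr_ge0.
have slackG_ge0 : 0 <= fine G - (mxdot y (\sum_i Q i *m x i) - b).
  by rewrite subr_ge0.
have sum_ge0 : 0 <= \sum_i (fine (F i) - (mxdot (- ((Q i)^T *m y)) (x i) - a i)).
  exact: sumr_ge0.
have G0 : fine G = mxdot y (\sum_i Q i *m x i) - b by lra.
have /eqP : \sum_i (fine (F i) - (mxdot (- ((Q i)^T *m y)) (x i) - a i)) = 0 by lra.
rewrite psumr_eq0// => /allP F0.
split=> [i|].
  apply: (subgradient_conjugate (Gamma_neqNy (fG i)) (ffin i)).
  have /eqP/subr0_eq <- := F0 i (mem_index_enum _).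
  exact: Ffin.
apply: (subgradient_conjugate (Gamma_neqNy gG) gE).
by rewrite -[LHS]/G Gfin G0.
Qed.

End optimality.

(** * The Lyapunov function *)

Lemma eq_cvgl (R : realType) (m n : nat) (T : Type) (F : set_system T)
    (u v : T -> 'M[R]_(m, n)) (l : 'M[R]_(m, n)) :
  (forall t, u t = v t) -> u @ F --> l -> v @ F --> l.
Proof. by move=> /funext ->. Qed.

(** * Laplacian and signless Laplacian of the graph *)

Section laplacian.
Context {R : realType} {N : nat} {E : rel 'I_N}.
Hypotheses (Esym : undirected E) (Econn : connected_graph E).

(* The Laplacian for c = 1 and the signless Laplacian for c = -1. *)
Definition laplacian (c : R) : 'M[R]_N :=
  \matrix_(i, j) ((i == j)%:R * (degree E j)%:R - c * (E i j)%:R).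

Lemma trmx_laplacian c : (laplacian c)^T = laplacian c.
Proof.
apply/matrixP => i j; rewrite !mxE (Esym j i).
by case: (eqVneq j i) => [->//|ji]; rewrite !mul0r.
Qed.

(** Turns the neighbour sums of the algorithm into matrix products: differences for [c = 1], sums
    for [c = -1]. *)
Lemma col_mul_laplacian c (m : nat) (Y : 'M[R]_(m, N)) i :
  col i (Y *m laplacian c)
  = \sum_(j in neighbors E i) (col i Y - c *: col j Y).
Proof.
rewrite sumrB sumr_const -scaler_sumr; apply/matrixP => a b.
rewrite !mxE summxE.
under eq_bigr do rewrite !mxE mulrBr.
rewrite sumrB; congr (_ - _).
  rewrite (bigD1 i)//= eqxx big1 ?addr0 => [|j ji].
    by rewrite mulmxnE mxE /degree mul1r mulr_natr.
  by rewrite (negPf ji) mul0r mulr0.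
rewrite mulr_sumr [RHS]big_mkcond/=; apply: eq_bigr => j _.
rewrite mxE inE (Esym j i); case: (E i j); rewrite /=; ring.
Qed.

(** Averaging the pairing over both orientations of each edge completes the square, since
    [c ^+ 2 = 1]; the average gives the factor [2^-1]. *)
Lemma laplacian_quadratic c (m : nat) (Y : 'M[R]_(m, N)) :
  c ^+ 2 = 1 ->
  mxdot Y (Y *m laplacian c) = 2^-1 * \sum_i \sum_(j | E i j)
    mxdot (col i Y - c *: col j Y) (col i Y - c *: col j Y).
Proof.
move=> c2; pose T i j := mxdot (col i Y) (col i Y - c *: col j Y).
have -> : mxdot Y (Y *m laplacian c) = \sum_i \sum_(j | E i j) T i j.
  rewrite mxdot_col; apply: eq_bigr => i _; rewrite col_mul_laplacian.
  rewrite /mxdot mulmx_sumr raddf_sum.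
  by under eq_bigl do rewrite inE.
have Tsym : \sum_i \sum_(j | E i j) T i j = \sum_i \sum_(j | E i j) T j i.
  rewrite (exchange_big_dep predT)//=; apply: eq_bigr => i _.
  by under eq_bigl do rewrite Esym.
suff -> : \sum_i \sum_(j | E i j)
    mxdot (col i Y - c *: col j Y) (col i Y - c *: col j Y) =
    \sum_i \sum_(j | E i j) T i j + \sum_i \sum_(j | E i j) T j i.
  by rewrite -Tsym; lra.
rewrite -big_split; apply: eq_bigr => i _ /=.
rewrite -big_split; apply: eq_bigr => j _ /=.
rewrite /T !mxdot_lin (mxdotC (col j Y) (col i Y)).
have cc x : c * (c * x) = x by rewrite mulrA -expr2 c2 mul1r.
by rewrite !mulrN cc opprK; ring.
Qed.

Lemma laplacian_ge0 c (m : nat) (Y : 'M[R]_(m, N)) :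
  c ^+ 2 = 1 -> 0 <= mxdot Y (Y *m laplacian c).
Proof.
move=> c2; rewrite laplacian_quadratic// mulr_ge0//.
by apply: sumr_ge0 => i _; apply: sumr_ge0 => j _; exact: mxdot_ge0.
Qed.

Lemma laplacian_edge c (m : nat) (Y : 'M[R]_(m, N)) i j :
  c ^+ 2 = 1 -> E i j ->
  mxdot (col i Y - c *: col j Y) (col i Y - c *: col j Y)
    <= 2 * mxdot Y (Y *m laplacian c).
Proof.
move=> c2 Eij; rewrite laplacian_quadratic// mulrA divff ?pnatr_eq0// mul1r.
rewrite (bigD1 i)//= (bigD1 j)//= -addrA lerDl.
apply: addr_ge0; first by apply: sumr_ge0 => k _; exact: mxdot_ge0.
by apply: sumr_ge0 => k _; apply: sumr_ge0 => l _; exact: mxdot_ge0.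
Qed.

Lemma connected_const (T : Type) (F : 'I_N -> T) i j :
  (forall i j, E i j -> F i = F j) -> F i = F j.
Proof.
move=> FE; have /connectP[p] := Econn i j.
elim: p i => [|k p IH] i /=; first by move=> _ ->.
by move=> /andP[/FE -> pth]; exact: IH.
Qed.

Local Notation L := (laplacian 1).

(** It suffices that [P] annihilates the cokernel of [L]. The quadratic form vanishes there, so
    cokernel vectors agree along edges and are constant by connectedness; columns with zero sum
    annihilate constants. *)
Lemma zero_sum_sub_laplacian (m : nat) (P : 'M[R]_(m, N)) :
  \sum_i col i P = 0 -> (P <= L)%MS.
Proof.
move=> P0; rewrite submxE; apply/eqP.
set C := cokermx L.
have CL : C^T *m L = 0.
  by rewrite -[L]trmx_laplacian -trmx_mul mulmx_coker trmx0.
have Ccol i j : E i j -> col i C^T = col j C^T.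
  move=> Eij; have := laplacian_edge C^T (expr1n _ 2) Eij.
  rewrite CL mxdot0r mulr0 scale1r => D0.
  apply/subr0_eq/matrixP => a b; rewrite [RHS]mxE.
  apply/eqP; rewrite -sqrf_eq0 eq_le sqr_ge0 andbT.
  exact: le_trans (sqr_entry_le_mxdot _ a b) D0.
apply/matrixP => a k; rewrite !mxE.
have CE i : C i k = C k k.
  have /matrixP/(_ k 0) := connected_const i k Ccol.
  by rewrite !mxE.
under eq_bigr do rewrite CE.
rewrite -mulr_suml.
have /matrixP/(_ a 0) := P0; rewrite summxE mxE.
by under eq_bigr do rewrite mxE; move=> ->; rewrite mul0r.
Qed.

(* On matrices whose columns add up to zero, which form the row space of the
   Laplacian, this is the quadratic form of its pseudo-inverse. *)
Definition dual_form (m : nat) (P : 'M[R]_(m, N)) := mxdot (P *m pinvmx L) P.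

Lemma mul_pinv_laplacian (m : nat) (P : 'M[R]_(m, N)) :
  (P <= L)%MS -> P *m pinvmx L *m L = P.
Proof. exact: mulmxKpV. Qed.

Lemma mxdot_laplacianC c (m : nat) (A B : 'M[R]_(m, N)) :
  mxdot (A *m laplacian c) B = mxdot A (B *m laplacian c).
Proof. by rewrite mxdot_mulr trmx_laplacian. Qed.

Lemma dual_formE (m : nat) (P : 'M[R]_(m, N)) :
  (P <= L)%MS -> dual_form P = mxdot (P *m pinvmx L) (P *m pinvmx L *m L).
Proof. by move=> PL; rewrite mul_pinv_laplacian. Qed.

Lemma dual_form_ge0 (m : nat) (P : 'M[R]_(m, N)) :
  (P <= L)%MS -> 0 <= dual_form P.
Proof. by move=> PL; rewrite dual_formE// laplacian_ge0// expr1n. Qed.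

(** The cross terms come from [P *m pinvmx L *m L = P] on the row space and the symmetry of [L],
    rather than from any symmetry of [pinvmx L]. *)
Lemma dual_formD (m : nat) (P Y : 'M[R]_(m, N)) a :
  (P <= L)%MS ->
  dual_form (P + a *: (Y *m L)) =
  dual_form P + 2 * a * mxdot Y P + a ^+ 2 * mxdot Y (Y *m L).
Proof.
move=> PL; rewrite /dual_form mulmxDl -scalemxAl !mxdot_lin.
have PKL := mul_pinv_laplacian PL.
have YKL : Y *m L *m pinvmx L *m L = Y *m L.
  by apply: mul_pinv_laplacian; exact: submxMl.
have -> : mxdot (P *m pinvmx L) (Y *m L) = mxdot Y P.
  by rewrite -mxdot_laplacianC PKL mxdotC.
have -> : mxdot (Y *m L *m pinvmx L) P = mxdot Y P.
  by rewrite -[in LHS]PKL -mxdot_laplacianC YKL mxdot_laplacianC PKL.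
have -> : mxdot (Y *m L *m pinvmx L) (Y *m L) = mxdot Y (Y *m L).
  by rewrite -mxdot_laplacianC YKL mxdotC.
ring.
Qed.

(** * The energy estimate along the recursion and its consequences *)

Section lyapunov.
Context {m : nat} {rho sigma : R}.
Hypotheses (rho0 : 0 < rho) (sigma0 : 0 < sigma).
Variables (Y Z P S X : nat -> 'M[R]_(m, N)).
Hypothesis P_rec : forall k, P k.+1 = P k + rho *: (Y k.+1 *m L).
Hypothesis S_rec : forall k, S k.+1 = S k + sigma *: (Y k.+1 - Z k.+1).
Hypothesis X_rec : forall k, X k.+1 =
  rho *: ((Y k.+1 - Y k) *m laplacian (-1)) + P k.+1 + S k.+1
  + sigma *: (Z k.+1 - Z k).
Hypothesis ZS_monotone : forall k, 0 <= mxdot (Z k.+1 - Z k) (S k.+1 - S k).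
Variables (y0 p0 s0 : 'M[R]_(m, N)).
Hypothesis y0_const : y0 *m L = 0.
Hypothesis PL : forall k, (P k - p0 <= L)%MS.
Hypothesis YX_monotone : forall k, mxdot (Y k - y0) (X k - (p0 + s0)) <= 0.
Hypothesis ZS0_monotone : forall k, 0 <= mxdot (Z k - y0) (S k - s0).

Definition lyapunov k : R :=
  rho * mxdot (Y k - y0) ((Y k - y0) *m laplacian (-1))
  + rho^-1 * dual_form (P k - p0)
  + sigma^-1 * mxdot (S k - s0) (S k - s0)
  + sigma * mxdot (Z k - y0) (Z k - y0).

Definition residual k : R :=
  rho * mxdot (Y k.+1 - Y k) ((Y k.+1 - Y k) *m laplacian (-1))
  + rho * mxdot (Y k.+1) (Y k.+1 *m L)
  + sigma * mxdot (Y k.+1 - Z k.+1) (Y k.+1 - Z k.+1)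
  + sigma * mxdot (Z k.+1 - Z k) (Z k.+1 - Z k).

Let lyapunov_terms k :
  [/\ 0 <= rho * mxdot (Y k - y0) ((Y k - y0) *m laplacian (-1)),
      0 <= rho^-1 * dual_form (P k - p0),
      0 <= sigma^-1 * mxdot (S k - s0) (S k - s0) &
      0 <= sigma * mxdot (Z k - y0) (Z k - y0)].
Proof.
split; rewrite mulr_ge0 ?invr_ge0 ?(ltW rho0) ?(ltW sigma0) ?mxdot_ge0//.
  by rewrite laplacian_ge0// sqrrN expr1n.
exact: dual_form_ge0.
Qed.

Lemma lyapunov_ge0 k : 0 <= lyapunov k.
Proof. by have [? ? ? ?] := lyapunov_terms k; rewrite !addr_ge0. Qed.

Let residual_terms k :
  [/\ 0 <= rho * mxdot (Y k.+1 - Y k) ((Y k.+1 - Y k) *m laplacian (-1)),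
      0 <= rho * mxdot (Y k.+1) (Y k.+1 *m L),
      0 <= sigma * mxdot (Y k.+1 - Z k.+1) (Y k.+1 - Z k.+1) &
      0 <= sigma * mxdot (Z k.+1 - Z k) (Z k.+1 - Z k)].
Proof.
split; rewrite mulr_ge0 ?(ltW rho0) ?(ltW sigma0) ?mxdot_ge0//.
  by rewrite laplacian_ge0// sqrrN expr1n.
by rewrite laplacian_ge0// expr1n.
Qed.

Lemma residual_ge0 k : 0 <= residual k.
Proof. by have [? ? ? ?] := residual_terms k; rewrite !addr_ge0. Qed.

(** Expanded in the errors at [k.+1] and the increments, the drop in excess of the residual is
    exactly a combination of the three monotonicity pairings, each entering with the favourable
    sign. *)
Lemma lyapunov_decrease k : lyapunov k.+1 + residual k <= lyapunov k.
Proof.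
pose a := Y k.+1 - y0; pose b := Z k.+1 - y0; pose s := S k.+1 - s0.
pose q := P k.+1 - p0; pose dy := Y k.+1 - Y k; pose dz := Z k.+1 - Z k.
pose A := laplacian (-1).
have YE : Y k - y0 = a - dy by rewrite /a /dy; apply/matrixP=> i j; rewrite !mxE; ring.
have ZE : Z k - y0 = b - dz by rewrite /b /dz; apply/matrixP=> i j; rewrite !mxE; ring.
have abE : Y k.+1 - Z k.+1 = a - b.
  by rewrite /a /b; apply/matrixP=> i j; rewrite !mxE; ring.
have SE : S k - s0 = s - sigma *: (a - b).
  by rewrite /s S_rec abE; apply/matrixP=> i j; rewrite !mxE; ring.
have PE : P k - p0 = q + (- rho) *: (Y k.+1 *m L).
  by rewrite /q P_rec; move: (_ *m _) => B; apply/matrixP=> i j; rewrite !mxE; ring.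
have mono1 := YX_monotone k.+1.
have XE : X k.+1 - (p0 + s0) = rho *: (dy *m A) + q + s + sigma *: dz.
  rewrite X_rec -/A -/dy; move: (_ *m _) => B.
  by rewrite /q /s; apply/matrixP=> i j; rewrite !mxE; ring.
have mono3 : 0 <= mxdot dz (a - b).
  have := ZS_monotone k; rewrite S_rec addrAC subrr add0r abE mxdotZr.
  by rewrite pmulr_rge0.
have mono2 := ZS0_monotone k.+1.
(* [q] lies in the row space of the symmetric [L] and [y0] in its kernel, so the two are
   orthogonal. *)
have qa : mxdot (Y k.+1) q = mxdot a q.
  have qK : q *m pinvmx L *m L = q := mul_pinv_laplacian (PL k.+1).
  rewrite [in RHS]/a mxdotDl mxdotNl -[in mxdot y0 q]qK.
  by rewrite -(mxdot_laplacianC _ y0) y0_const (mxdotC 0) mxdot0r subr0.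
have adyA : mxdot dy (a *m A) = mxdot a (dy *m A).
  by rewrite -mxdot_laplacianC mxdotC.
rewrite /lyapunov /residual -/A -/dy -/dz -/a -/b -/s -/q YE ZE SE PE abE.
rewrite dual_formD ?PL// qa.
move: mono1 mono2 mono3; rewrite XE -/a -/b -/s.
clearbody a b s q dy dz A.
rewrite mulmxBl !mxdot_lin adyA.
rewrite (mxdotC s a) (mxdotC s b) (mxdotC b a) (mxdotC dz a) (mxdotC dz b).
move: (dual_form q) (mxdot (Y k.+1) _) => D YY.
move: (mxdot a (dy *m A)) (mxdot a (a *m A)) (mxdot dy (dy *m A)) => t1 t2 t3.
move: (mxdot a q) (mxdot a s) (mxdot b s) (mxdot s s) => t4 t5 t6 t7.
move: (mxdot a dz) (mxdot b dz) (mxdot dz dz) => t8 t9 t10.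
move: (mxdot a a) (mxdot a b) (mxdot b b) => t11 t12 t13.
move=> h1 h2 h3.
rewrite -subr_ge0.
set rhs := (X in _ <= X).
have -> : rhs =
    - 2 * (rho * t1 + t4 + t5 + sigma * t8) + 2 * t6 + 2 * sigma * (t8 - t9).
  by rewrite /rhs; field; rewrite !gt_eqF.
have := mulr_ge0 (ltW sigma0) h3.
lra.
Qed.

Lemma lyapunov_le k : lyapunov k <= lyapunov 0.
Proof.
elim: k => // k IH; apply: le_trans IH; apply: le_trans (lyapunov_decrease k).
by rewrite lerDl residual_ge0.
Qed.

Lemma lyapunov_is_cvg : cvgn lyapunov.
Proof.
apply: nonincreasing_is_cvgn.
  apply/nonincreasing_seqP => k; apply: le_trans (lyapunov_decrease k).
  by rewrite lerDl residual_ge0.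
by exists 0 => _ [k _ <-]; exact: lyapunov_ge0.
Qed.

Lemma residual_cvg0 : residual @ \oo --> (0 : R).
Proof.
have [l Vl] : exists l : R, lyapunov @ \oo --> l.
  by exists (limn lyapunov); exact: lyapunov_is_cvg.
apply: (@squeeze_cvgr _ _ _ _ (cst 0) (fun k => lyapunov k - lyapunov k.+1)).
- apply: nearW => k; rewrite residual_ge0/= lerBrDl; exact: lyapunov_decrease.
- exact: cvg_cst.
- rewrite -(subrr l); apply: cvgB => //.
  by rewrite (cvg_shiftS lyapunov).
Qed.

Lemma residual_termP (F : nat -> R) (c : R) :
  0 < c -> (forall k, 0 <= F k) -> (forall k, c * F k <= residual k) ->
  F @ \oo --> (0 : R).
Proof.
move=> c0 F0 Fr.
apply: (@squeeze_cvgr _ _ _ _ (cst 0) (fun k => c^-1 * residual k)).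
- by apply: nearW => k; rewrite F0/= ler_pdivlMl.
- exact: cvg_cst.
- rewrite -(mulr0 c^-1); apply: cvgM; first exact: cvg_cst.
  exact: residual_cvg0.
Qed.

Lemma cvg_shift0 (l n : nat) (u : nat -> 'M[R]_(l, n)) :
  (fun k => mxdot (u k.+1) (u k.+1)) @ \oo --> (0 : R) ->
  u @ \oo --> (0 : 'M[R]_(l, n)).
Proof. by move=> u0; rewrite -(cvg_shiftS u); exact: mxdot_cvg0. Qed.

Lemma consensus_YZ : (fun k => Y k - Z k) @ \oo --> (0 : 'M[R]_(m, N)).
Proof.
apply: cvg_shift0; apply: (residual_termP sigma0) => k; first exact: mxdot_ge0.
rewrite /residual; have [? ? ? ?] := residual_terms k; lra.
Qed.

Lemma successive_Z : (fun k => Z k.+1 - Z k) @ \oo --> (0 : 'M[R]_(m, N)).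
Proof.
apply: mxdot_cvg0; apply: (residual_termP sigma0) => k; first exact: mxdot_ge0.
rewrite /residual; have [? ? ? ?] := residual_terms k; lra.
Qed.

(** The residual sees the increments of [Y] only through the signless Laplacian, which is singular
    on bipartite graphs; they are recovered from those of [Z] and the gap [Y - Z]. *)
Lemma successive_Y : (fun k => Y k.+1 - Y k) @ \oo --> (0 : 'M[R]_(m, N)).
Proof.
have YZ1 : (fun k => Y k.+1 - Z k.+1) @ \oo --> (0 : 'M[R]_(m, N)).
  by rewrite (cvg_shiftS (fun k => Y k - Z k)); exact: consensus_YZ.
have h : (fun k => Y k.+1 - Z k.+1 + (Z k.+1 - Z k) - (Y k - Z k)) @ \oo
    --> (0 + 0 - 0 : 'M[R]_(m, N)).
  apply: cvgB; last exact: consensus_YZ.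
  by apply: cvgD; [exact: YZ1|exact: successive_Z].
rewrite addr0 subr0 in h; apply: (eq_cvgl _ h) => k.
by apply/matrixP => i j; rewrite !mxE; ring.
Qed.

Lemma consensus_edge i j : E i j ->
  (fun k => col i (Y k) - col j (Y k)) @ \oo --> (0 : 'cV[R]_m).
Proof.
move=> Eij; apply: cvg_shift0.
have r2 : 0 < rho / 2 by rewrite divr_gt0.
apply: (residual_termP r2) => k; first exact: mxdot_ge0.
have := laplacian_edge (Y k.+1) (expr1n _ 2) Eij; rewrite scale1r => le.
rewrite /residual; have [? ? ? ?] := residual_terms k.
have : rho / 2 * mxdot (col i (Y k.+1) - col j (Y k.+1))
      (col i (Y k.+1) - col j (Y k.+1))
    <= rho / 2 * (2 * mxdot (Y k.+1) (Y k.+1 *m L)) by rewrite ler_pM2l.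
lra.
Qed.

Lemma stationarity : (fun k => X k - (P k + S k)) @ \oo --> (0 : 'M[R]_(m, N)).
Proof.
rewrite -(cvg_shiftS (fun k => X k - (P k + S k))) /=.
have h : (fun k => rho *: ((Y k.+1 - Y k) *m laplacian (-1))
    + sigma *: (Z k.+1 - Z k)) @ \oo
    --> (rho *: (0 *m laplacian (-1)) + sigma *: 0 : 'M[R]_(m, N)).
  apply: cvgD; apply: cvgZl_tmp; last exact: successive_Z.
  exact: cvg_mulmxr successive_Y.
rewrite mul0mx !scaler0 addr0 in h; apply: (eq_cvgl _ h) => k.
rewrite X_rec; move: (_ *m _) => B.
by apply/matrixP => i j; rewrite !mxE; ring.
Qed.

Definition ebounded (l n : nat) (u : nat -> 'M[R]_(l, n)) :=
  exists B, \forall k \near \oo, forall i j, `|u k i j| <= B.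

Lemma ebounded_mxdot (l n : nat) (u : nat -> 'M[R]_(l, n)) c B :
  (forall k, mxdot (u k.+1 - c) (u k.+1 - c) <= B) -> ebounded u.
Proof.
move=> uB; exists (1 + B + `|c|); exists 1%N => //= -[//|k] _ i j.
rewrite -(subrK c (u k.+1)) mxE (le_trans (ler_normD _ _))// lerD ?ler_mxnorm_entry//.
have := le_trans (sqr_entry_le_mxdot (u k.+1 - c) i j) (uB k).
set t := (u k.+1 - c) i j => tB; rewrite -[leLHS]mulr1.
(* Gives [2 |t| <= 1 + t^2], so a bound on the square bounds the entry without a square root. *)
have : 0 <= (`|t| - 1) ^+ 2 by rewrite sqr_ge0.
have : 0 <= B by apply: le_trans tB; rewrite sqr_ge0.
by rewrite -(real_normK (num_real t)) in tB *; nra.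
Qed.

Lemma ebounded_Z : ebounded Z.
Proof.
apply: (@ebounded_mxdot _ _ _ y0 (sigma^-1 * lyapunov 0)) => k.
rewrite ler_pdivlMl//; apply: le_trans (lyapunov_le k.+1); rewrite /lyapunov.
have [? ? ? ?] := lyapunov_terms k.+1; lra.
Qed.

Lemma ebounded_S : ebounded S.
Proof.
apply: (@ebounded_mxdot _ _ _ s0 (sigma * lyapunov 0)) => k.
rewrite -ler_pdivrMl//; apply: le_trans (lyapunov_le k.+1); rewrite /lyapunov.
have [? ? ? ?] := lyapunov_terms k.+1; lra.
Qed.

Lemma ebounded_Y : ebounded Y.
Proof.
have [B1 ZB] := ebounded_Z.
have [B2 YZB] : ebounded (fun k => Y k - Z k).
  apply: (@ebounded_mxdot _ _ _ 0 (sigma^-1 * lyapunov 0)) => k.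
  rewrite subr0 ler_pdivlMl//; apply: le_trans (lyapunov_le k).
  apply: le_trans (lyapunov_decrease k); have := lyapunov_ge0 k.+1.
  rewrite /residual; have [? ? ? ?] := residual_terms k; lra.
exists (B2 + B1); apply: filterS2 YZB ZB => k h1 h2 i j.
by rewrite -(subrK (Z k) (Y k)) mxE (le_trans (ler_normD _ _))// lerD//.
Qed.

(** The potential [v] with [v *m L = P k - p0] may be unbounded, but the quadratic form bounds its
    edge differences, and the columns of [P k - p0] are sums of these. *)
Lemma ebounded_P : ebounded P.
Proof.
(* Bounds an entry of one edge difference, whose square is at most [2 * (rho * lyapunov 0)]; each
   column sums at most [N] of them. *)
pose B := 1 + 2 * (rho * lyapunov 0).
exists (\sum_(j < N) B + `|p0|); apply: nearW => k a i.
rewrite -(subrK p0 (P k)) mxE (le_trans (ler_normD _ _))// lerD ?ler_mxnorm_entry//.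
pose v := (P k - p0) *m pinvmx L.
have vL : v *m L = P k - p0 by rewrite mul_pinv_laplacian.
have vB : mxdot v (v *m L) <= rho * lyapunov 0.
  rewrite -dual_formE// -ler_pdivrMl//; apply: le_trans (lyapunov_le k).
  rewrite /lyapunov.
  have [? ? ? ?] := lyapunov_terms k; lra.
have -> : (P k - p0) a i = col i (v *m L) a 0 by rewrite vL [RHS]mxE.
have B0 : 0 <= B by rewrite addr_ge0// mulr_ge0// mulr_ge0 ?(ltW rho0) ?lyapunov_ge0.
rewrite col_mul_laplacian summxE (le_trans (ler_norm_sum _ _ _))//.
rewrite [leRHS](bigID (mem (neighbors E i)))/= -[leLHS]addr0 lerD//; last first.
  exact: sumr_ge0.
apply: ler_sum => j; rewrite inE => Eij.
have := le_trans (sqr_entry_le_mxdot _ a 0) (laplacian_edge v (expr1n _ 2) Eij).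
set t := (_ : 'cV__) a 0.
have : 0 <= (`|t| - 1) ^+ 2 by rewrite sqr_ge0.
by rewrite -(real_normK (num_real t)) /B; nra.
Qed.

Lemma asymptotics :
  [/\ (fun k => Y k - Z k) @ \oo --> (0 : 'M[R]_(m, N)),
      forall i j, E i j ->
        (fun k => col i (Y k) - col j (Y k)) @ \oo --> (0 : 'cV[R]_m),
      (fun k => X k - (P k + S k)) @ \oo --> (0 : 'M[R]_(m, N)) &
      [/\ ebounded Y, ebounded Z, ebounded P & ebounded S]].
Proof.
split; [exact: consensus_YZ|exact: consensus_edge|exact: stationarity|].
by split; [exact: ebounded_Y|exact: ebounded_Z|exact: ebounded_P|exact: ebounded_S].
Qed.

(** Fejer monotonicity: [lyapunov] converges along [\oo] and tends to 0 along the finer [U], hence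
    to 0 altogether. It controls [Z], and [Y] follows by consensus. *)
Lemma lyapunov_cvg0 (U : set_system nat) {UF : ProperFilter U} :
  \oo `<=` U -> Y @ U --> y0 -> Z @ U --> y0 -> P @ U --> p0 -> S @ U --> s0 ->
  Y @ \oo --> y0 /\ Z @ \oo --> y0.
Proof.
move=> ooU YU ZU PU SU.
have sub0 (u : nat -> 'M[R]_(m, N)) (c : 'M[R]_(m, N)) :
    u @ U --> c -> (fun k => u k - c) @ U --> (0 : 'M[R]_(m, N)).
  by move=> uc; rewrite -(subrr c); apply: cvgB => //; exact: cvg_cst.
have scaled0 c (u v : nat -> 'M[R]_(m, N)) : u @ U --> (0 : 'M[R]_(m, N)) ->
    v @ U --> (0 : 'M[R]_(m, N)) ->
    (fun k => c * mxdot (u k) (v k)) @ U --> (0 : R).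
  move=> u0 v0; rewrite -(mulr0 c) -(mxdot0r (0 : 'M[R]_(m, N))).
  by apply: cvgM; [exact: cvg_cst|exact: cvg_mxdot].
have mulM0 (c : 'M[R]_(m, N)) (M : 'M[R]_N) (u : nat -> 'M[R]_(m, N)) : u @ U --> c ->
    (fun k => (u k - c) *m M) @ U --> (0 : 'M[R]_(m, N)).
  by move=> uc; rewrite -(mul0mx m M); apply: cvg_mulmxr; exact: sub0.
have VU : lyapunov @ U --> (0 : R).
  rewrite -[X in _ --> X](_ : 0 + 0 + 0 + 0 = 0 :> R); last by rewrite !addr0.
  apply: cvgD; [apply: cvgD; [apply: cvgD|]|].
  - exact: scaled0 (sub0 _ _ YU) (mulM0 _ _ _ YU).
  - exact: scaled0 (mulM0 _ _ _ PU) (sub0 _ _ PU).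
  - exact: scaled0 (sub0 _ _ SU) (sub0 _ _ SU).
  - exact: scaled0 (sub0 _ _ ZU) (sub0 _ _ ZU).
have V0 : lyapunov @ \oo --> (0 : R).
  have [l Vl] : exists l : R, lyapunov @ \oo --> l.
    by exists (limn lyapunov); exact: lyapunov_is_cvg.
  have VUl : lyapunov @ U --> l by apply: cvg_trans Vl => A; exact: ooU.
  by rewrite -(cvg_unique _ VUl VU).
have Z0 : (fun k => Z k - y0) @ \oo --> (0 : 'M[R]_(m, N)).
  apply: mxdot_cvg0.
  apply: (@squeeze_cvgr _ _ _ _ (cst 0) (fun k => sigma^-1 * lyapunov k)).
  - apply: nearW => k; rewrite mxdot_ge0/= ler_pdivlMl// /lyapunov.
    have [? ? ? ?] := lyapunov_terms k; lra.
  - exact: cvg_cst.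
  - by rewrite -(mulr0 sigma^-1); apply: cvgM => //; exact: cvg_cst.
have ZE : Z @ \oo --> y0.
  have h : (fun k => Z k - y0 + y0) @ \oo --> (0 + y0 : 'M[R]_(m, N)).
    by apply: cvgD => //; exact: cvg_cst.
  by rewrite add0r in h; apply: (eq_cvgl _ h) => k; rewrite subrK.
split=> //.
have h : (fun k => Y k - Z k + Z k) @ \oo --> (0 + y0 : 'M[R]_(m, N)).
  by apply: cvgD => //; exact: consensus_YZ.
by rewrite add0r in h; apply: (eq_cvgl _ h) => k; rewrite subrK.
Qed.

End lyapunov.

End laplacian.

(** * The iterates *)

Section columns.
Context {R : realType}.

Definition mx_of_cols (m N : nat) (u : 'I_N -> 'cV[R]_m) : 'M[R]_(m, N) :=
  \matrix_(a, i) u i a 0.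

Lemma col_mx_of_cols (m N : nat) (u : 'I_N -> 'cV[R]_m) i :
  col i (mx_of_cols u) = u i.
Proof. by apply/matrixP => a b; rewrite !mxE ord1. Qed.

Lemma eq_col (m N : nat) (A B : 'M[R]_(m, N)) :
  (forall i, col i A = col i B) -> A = B.
Proof.
by move=> AB; apply/matrixP => a i; have /matrixP/(_ a 0) := AB i; rewrite !mxE.
Qed.

Lemma min_value_argmin (T : Type) (A : set T) (F : T -> \bar R) x :
  argmin A F x -> min_value A F = F x.
Proof.
move=> [Ax xmin]; apply/eqP; rewrite eq_le; apply/andP; split.
  by apply: ge_ereal_inf; exists (F x) => //; exists x.
by apply/ereal_infP => _ [w Aw <-]; exact: xmin.
Qed.

Lemma max_value_argmax (T : Type) (A : set T) (F : T -> \bar R) x :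
  argmax A F x -> max_value A F = F x.
Proof.
move=> [Ax xmax]; apply/eqP; rewrite eq_le; apply/andP; split.
  by apply: ge_ereal_sup => _ [w Aw <-]; exact: xmax.
by apply: ereal_sup_ubound; exists x.
Qed.

Lemma acceptable_argmin (n : nat) (F : 'cV[R]_n -> \bar R) (M : R) x :
  acceptable F M -> argmin (box M) F x -> argmin setT F x.
Proof.
move=> [_ le] xmin; split=> // w _; rewrite -(min_value_argmin xmin).
by apply: le_trans le _; apply: ge_ereal_inf; exists (F w) => //; exists w.
Qed.

(** A box containing some global minimiser passes the test; this is what stops the doubling. *)
Lemma argmin_acceptable (n : nat) (F : 'cV[R]_n -> \bar R) (B M : R) :
  (exists w, (F w < +oo)%E) -> (argmin setT F `&` box B) !=set0 -> B <= M ->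
  acceptable F M.
Proof.
move=> [w Fw] [x [xmin xB]] BM; have xM : box M x by apply: le_trans xB BM.
split; first by exists x => //; apply: le_lt_trans Fw; exact: (proj2 xmin).
rewrite (min_value_argmin xmin).
by apply: ge_ereal_inf; exists (F x) => //; exists x.
Qed.

(** If no [B] works, the times [k >= K] at which [A B] fails generate a proper filter, by
    monotonicity in [B], and an ultrafilter refining it contradicts the second hypothesis. This
    replaces a finite covering argument. *)
Lemma ultra_large_bound (A : R -> set nat) :
  (forall B B', B <= B' -> A B `<=` A B') ->
  (forall U, UltraFilter U -> \oo `<=` U -> exists B, U (A B)) ->
  exists B, \forall k \near \oo, A B k.
Proof.
move=> Amono AU; apply: contrapT => nA.
pose D (BK : R * nat) := [set k | (BK.2 <= k)%N /\ ~ A BK.1 k].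
have FD : ProperFilter (filter_from setT D).
  apply: filter_from_proper.
    apply: filter_from_filter; first by exists (0, 0%N).
    move=> [B K] [B' K'] _ _; exists (Num.max B B', maxn K K') => // k [/=].
    rewrite geq_max => /andP[Kk K'k] nk; split; split=> //= Ak; apply: nk.
      by apply: Amono Ak; rewrite le_max lexx.
    by apply: Amono Ak; rewrite le_max lexx orbT.
  move=> [B K] _; apply: contrapT => D0; apply: nA; exists B, K => // k Kk.
  by apply: contrapT => nAk; apply: D0; exists k.
have [U [UU FU]] := ultraFilterLemma FD.
have [|B UB] := AU U UU.
  move=> C [K _ KC]; apply: FU; exists (0, K) => // k [Kk _]; exact: KC.
have UnB : U (~` A B) by apply: FU; exists (B, 0%N) => // k [].
by have [k []] := filter_ex (filterI UB UnB).
Qed.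

End columns.

Unset Implicit Arguments.

(** * Subgradient relations and matrix recursion of the iterates *)

Section admm.
Variables (R : realType) (N m : nat) (n : 'I_N -> nat).
Variables (f : forall i : 'I_N, 'cV[R]_(n i) -> \bar R).
Variables (Q : forall i : 'I_N, 'M[R]_(m, n i)) (g : 'cV[R]_m -> \bar R).
Variables (E : rel 'I_N) (sigma rho : R).
Variables (p s r y z : nat -> 'I_N -> 'cV[R]_m).
Variables (x : nat -> forall i : 'I_N, 'cV[R]_(n i)) (M : nat -> 'I_N -> R).
Hypotheses (N_gt0 : (0 < N)%N) (g_Gamma : Gamma g).
Hypothesis f_Gamma : forall i, Gamma (f i).
Hypotheses (E_connected : connected_graph E) (E_undirected : undirected E).
Hypotheses (sigma_gt0 : 0 < sigma) (rho_gt0 : 0 < rho).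
Hypothesis p0 : forall i, p 0%N i = 0.
Hypothesis M_gt0 : forall i, 0 < M 0%N i.
Hypothesis iterates : dual_consensus_admm f Q g E sigma rho p s r y z x M.

Let c i : R := sigma + 2 * rho * (degree E i)%:R.

Let c_gt0 i : 0 < c i.
Proof. by rewrite ltr_wpDr// mulr_ge0// mulr_ge0// ltW. Qed.

Let Nsigma_gt0 : 0 < N%:R * sigma.
Proof. by rewrite mulr_gt0// ltr0n. Qed.

(** The update of [y] is the multiplier in Fermat's rule for the local problem, of which [x] is a
    global minimiser by the box test. *)
Lemma primal_subgradient k i :
  subgradient (f i) (x k.+1 i) (- ((Q i)^T *m y k.+1 i)).
Proof.
rewrite (admm_y iterates); apply: argmin_subgradient => //; first exact: c_gt0.
have [t [_ acc _]] := admm_M iterates k i.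
exact: acceptable_argmin acc (admm_x iterates k i).
Qed.

(** Moreau's decomposition: after the update of [z], the next [s] scaled by [N] is the proximal
    point itself, and [z] is the corresponding subgradient. *)
Lemma dual_subgradient k i :
  subgradient g (N%:R *: s k.+2 i) (z k.+1 i).
Proof.
have [q qprox zE] := admm_z iterates k i.
set pt := N%:R *: _ in qprox.
have N0 : (N%:R : R) != 0 by rewrite pnatr_eq0 -lt0n.
have sigma0 : sigma != 0 by rewrite gt_eqF.
have sE : N%:R *: s k.+2 i = q.
  rewrite (admm_s iterates k.+1) zE; apply/matrixP => a b; rewrite !mxE.
  by field; apply/andP.
(* The matrix [- 1%:M] casts the proximal problem into the form of Fermat's rule, with residual
   [pt - q]. *)
have zE' : z k.+1 i = - ((- 1%:M)^T *m ((N%:R * sigma)^-1 *: (- 1%:M *m q + pt))).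
  rewrite zE raddfN/= trmx1 !mulNmx !mul1mx opprK.
  apply/matrixP => a b; rewrite /pt !mxE.
  by field; apply/andP.
rewrite sE zE'; apply: argmin_subgradient => //.
rewrite /prox in qprox.
suff <- : (fun w => (g w + ((N%:R * sigma)^-1 / 2 * enorm (pt - w) ^+ 2)%:E)%E) =
    (fun w => (g w + ((2 * (N%:R * sigma))^-1 * enorm (- 1%:M *m w + pt) ^+ 2)%:E)%E).
  by [].
apply/funext => w; have -> : - 1%:M *m w + pt = pt - w.
  by rewrite mulNmx mul1mx addrC.
by have -> : (2 * (N%:R * sigma))^-1 = (N%:R * sigma)^-1 / 2 by rewrite invfM mulrC.
Qed.

(** Indices start where the subgradient relations hold. [p] and [s] run one step ahead: [z k.+1] is
    a subgradient at [N%:R *: s k.+2], and [p k.+2] is the first [p] to use [y k.+1]. *)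
Definition Ymx k := mx_of_cols (y k.+1).
Definition Zmx k := mx_of_cols (z k.+1).
Definition Pmx k := mx_of_cols (p k.+2).
Definition Smx k := mx_of_cols (s k.+2).
Definition Xmx k := mx_of_cols (fun i => Q i *m x k.+1 i).

Let colD (A B : 'M[R]_(m, N)) i : col i (A + B) = col i A + col i B.
Proof. exact: raddfD. Qed.
Let colN (A : 'M[R]_(m, N)) i : col i (- A) = - col i A.
Proof. exact: raddfN. Qed.
Let colZ a (A : 'M[R]_(m, N)) i : col i (a *: A) = a *: col i A.
Proof. by apply/matrixP => b j; rewrite !mxE. Qed.

Lemma Pmx_rec k : Pmx k.+1 = Pmx k + rho *: (Ymx k.+1 *m laplacian (E := E) 1).
Proof.
apply: eq_col => i; rewrite colD colZ col_mul_laplacian// !col_mx_of_cols.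
rewrite (admm_p iterates); congr (_ + _ *: _); apply: eq_bigr => j _.
by rewrite !col_mx_of_cols scale1r.
Qed.

Lemma Smx_rec k : Smx k.+1 = Smx k + sigma *: (Ymx k.+1 - Zmx k.+1).
Proof.
apply: eq_col => i; rewrite colD colZ colD colN !col_mx_of_cols.
exact: (admm_s iterates).
Qed.

(** Eliminates [r] through [Q x = c y - r]. The part [2 rho d y] of [c y] splits into neighbour
    differences, absorbed by [p], and neighbour sums, which give the signless Laplacian. *)
Lemma Xmx_rec k : Xmx k.+1 =
  rho *: ((Ymx k.+1 - Ymx k) *m laplacian (E := E) (-1)) + Pmx k.+1 + Smx k.+1
  + sigma *: (Zmx k.+1 - Zmx k).
Proof.
apply: eq_col => i; rewrite !colD !colZ colD colN col_mul_laplacian// !col_mx_of_cols.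
under eq_bigr do rewrite !colD !colN !col_mx_of_cols.
have -> : Q i *m x k.+2 i = c i *: y k.+2 i - r k.+2 i.
  by rewrite (admm_y iterates) scalerA divff ?gt_eqF// scale1r addrK.
rewrite (admm_r iterates k.+1) (admm_p iterates k.+2) (admm_s iterates k.+2).
rewrite !sumrB !big_split/= -!scaler_sumr !sumrB !sumr_const -/(degree E i) /c.
apply/matrixP => a b; rewrite !mxE !mulmxnE.
ring.
Qed.

Lemma ZS_monotone k : 0 <= mxdot (Zmx k.+1 - Zmx k) (Smx k.+1 - Smx k).
Proof.
rewrite mxdot_col; apply: sumr_ge0 => i _; rewrite !colD !colN !col_mx_of_cols.
have := subgradient_monotone g_Gamma (dual_subgradient k.+1 i) (dual_subgradient k i).
by rewrite -scalerBr mxdotZr pmulr_rge0// ltr0n.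
Qed.

(** Symmetry of the edges makes the increments cancel, and [p] starts at 0. *)
Lemma sum_p k : \sum_i p k i = 0.
Proof.
elim: k => [|k IH]; first by apply: big1 => i _.
under eq_bigr do rewrite (admm_p iterates).
rewrite big_split/= IH add0r -scaler_sumr.
under eq_bigr do (under eq_bigl do rewrite inE; rewrite sumrB).
rewrite sumrB (exchange_big_dep predT)//=.
rewrite [X in _ - X](eq_bigr (fun i => \sum_(j | E j i) y k j)).
  by rewrite subrr scaler0.
by move=> i _; apply: eq_bigl => j; exact: E_undirected.
Qed.

(* A primal-dual solution in which the argument of g is split among the agents
   in possibly unequal parts, as happens for limits of the iterates. *)
Definition split_kkt (xs : forall i, 'cV[R]_(n i)) (ys : 'cV[R]_m)
    (ss : 'I_N -> 'cV[R]_m) :=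
  [/\ forall i, subgradient (f i) (xs i) (- ((Q i)^T *m ys)),
      forall i, subgradient g (N%:R *: ss i) ys &
      \sum_i Q i *m xs i = \sum_i ss i].

Lemma split_kkt_kkt xs ys ss : split_kkt xs ys ss -> kkt f Q g xs ys.
Proof.
by move=> [fs gs eq]; split=> //; rewrite eq; exact: subgradient_mean.
Qed.

Lemma kkt_split_kkt xs ys : kkt f Q g xs ys ->
  split_kkt xs ys (fun=> N%:R^-1 *: \sum_i Q i *m xs i).
Proof.
have N0 : (N%:R : R) != 0 by rewrite pnatr_eq0 -lt0n.
move=> [fs gs]; split=> // [i|]; first by rewrite scalerA divff// scale1r.
by rewrite sumr_const card_ord -scaler_nat scalerA divff// scale1r.
Qed.

Section reference_point.
Variables (xs : forall i, 'cV[R]_(n i)) (ys : 'cV[R]_m) (ss : 'I_N -> 'cV[R]_m).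
Hypothesis ref : split_kkt xs ys ss.

Let y0 := mx_of_cols (fun _ : 'I_N => ys).
(** The value of [p] for which [Q i *m xs i] is [p] plus [s]; its columns add up to zero by the last
    condition of [split_kkt]. *)
Let q0 := mx_of_cols (fun i => Q i *m xs i - ss i).
Let s0 := mx_of_cols ss.

Lemma ref_y : y0 *m laplacian (E := E) 1 = 0.
Proof.
apply: eq_col => i; rewrite col_mul_laplacian// big1 ?linear0// => j _.
by rewrite !col_mx_of_cols scale1r subrr.
Qed.

Lemma ref_p k : (Pmx k - q0 <= laplacian (E := E) 1)%MS.
Proof.
apply: zero_sum_sub_laplacian => //.
under eq_bigr do rewrite colD colN !col_mx_of_cols.
by rewrite !sumrB sum_p; case: ref => _ _ ->; rewrite subrr subr0.
Qed.

Lemma ref_x k : mxdot (Ymx k - y0) (Xmx k - (q0 + s0)) <= 0.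
Proof.
rewrite mxdot_col; apply: sumr_le0 => i _; rewrite !(colD, colN) !col_mx_of_cols.
case: ref => fs _ _; rewrite subrK.
have := subgradient_monotone (f_Gamma i) (primal_subgradient k i) (fs i).
rewrite -opprD -mulmxBr mxdotNl oppr_ge0 mxdot_mull trmxK.
by rewrite mulmxBr.
Qed.

Lemma ref_z k : 0 <= mxdot (Zmx k - y0) (Smx k - s0).
Proof.
rewrite mxdot_col; apply: sumr_ge0 => i _; rewrite !(colD, colN) !col_mx_of_cols.
case: ref => _ gs _.
have := subgradient_monotone g_Gamma (dual_subgradient k i) (gs i).
by rewrite -scalerBr mxdotZr pmulr_rge0// ltr0n.
Qed.

Definition ref_asymptotics := asymptotics E_undirected rho_gt0 sigma_gt0
  Pmx_rec Smx_rec Xmx_rec ZS_monotone ref_y ref_p ref_x ref_z.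

Lemma ref_cvg (U : set_system nat) {UF : ProperFilter U} :
  \oo `<=` U -> Ymx @ U --> y0 -> Zmx @ U --> y0 -> Pmx @ U --> q0 ->
  Smx @ U --> s0 -> Ymx @ \oo --> y0 /\ Zmx @ \oo --> y0.
Proof.
exact: (lyapunov_cvg0 E_undirected rho_gt0 sigma_gt0
  Pmx_rec Smx_rec Xmx_rec ZS_monotone ref_y ref_p ref_x ref_z).
Qed.

End reference_point.

(** * Limit points of the iterates and boundedness of [x] *)

Hypothesis ref_exists : exists xs ys ss, split_kkt xs ys ss.
Hypothesis locally_bounded : forall (i : 'I_N) (rt : 'cV[R]_m),
  exists Rad Mbar : R, 0 < Rad /\
    forall k : nat, enorm (r k.+1 i - rt) <= Rad ->
      (argmin setT
         (local_obj (f i) (Q i) sigma rho (degree E i) (r k.+1 i))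
       `&` box Mbar) !=set0.

(** Boundedness gives the limits; vanishing edge differences and connectedness make the columns of
    that of [Y] equal. Of [x], only the products [Q i *m x] are controlled at this stage. *)
Lemma ultra_limits (U : set_system nat) {UU : UltraFilter U} :
  \oo `<=` U -> exists (ys : 'cV[R]_m) (P' S' : 'M[R]_(m, N)),
  [/\ Ymx @ U --> mx_of_cols (fun _ : 'I_N => ys),
      Zmx @ U --> mx_of_cols (fun _ : 'I_N => ys) &
      [/\ Pmx @ U --> P', Smx @ U --> S', Xmx @ U --> P' + S' &
          \sum_i col i P' = 0]].
Proof.
move=> ooU; have [xs [ys0 [ss ref]]] := ref_exists.
have [YZ Yedge stat [[BY Yb] [BZ Zb] [BP Pb] [BS Sb]]] := ref_asymptotics xs ys0 ss ref.
have ex (u : nat -> 'M[R]_(m, N)) B :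
    (\forall k \near \oo, forall i j, `|u k i j| <= B) ->
    exists l : 'M[R]_(m, N), u @ U --> l.
  move=> uB; apply: (@ultra_bounded_cvg _ _ U UU _ _ u B) => i j.
  by apply: ooU; apply: filterS uB => k; exact.
have [Y' Y'E] := ex _ _ Yb; have [Z' Z'E] := ex _ _ Zb.
have [P' P'E] := ex _ _ Pb; have [S' S'E] := ex _ _ Sb.
have toU (a b : nat) (u : nat -> 'M[R]_(a, b)) (l : 'M[R]_(a, b)) :
    u @ \oo --> l -> u @ U --> l.
  by move=> ul; apply: cvg_trans ul => A; exact: ooU.
have YZ' : Y' = Z'.
  apply/subr0_eq; have h : (fun k => Ymx k - Zmx k) @ U --> Y' - Z' by exact: cvgB.
  exact: (cvg_unique _ h (toU _ _ _ _ YZ)).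
have Yconst : Y' = mx_of_cols (fun _ : 'I_N => col (Ordinal N_gt0) Y').
  apply: eq_col => i; rewrite col_mx_of_cols.
  apply: (connected_const E_connected i (Ordinal N_gt0) (F := fun i => col i Y')).
  move=> j l Ejl; apply/subr0_eq.
  have h : (fun k => col j (Ymx k) - col l (Ymx k)) @ U --> col j Y' - col l Y'.
    by apply: cvgB; exact: cvg_col.
  exact: (cvg_unique _ h (toU _ _ _ _ (Yedge _ _ Ejl))).
exists (col (Ordinal N_gt0) Y'), P', S'; rewrite -Yconst.
split; [exact: Y'E|by rewrite YZ'; exact: Z'E|split; [exact: P'E|exact: S'E| |]].
  have h : (fun k => Xmx k - (Pmx k + Smx k) + (Pmx k + Smx k)) @ U
      --> (0 + (P' + S') : 'M[R]_(m, N)).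
    by apply: cvgD; [exact: toU stat|exact: cvgD].
  by rewrite add0r in h; apply: (eq_cvgl _ h) => k; rewrite subrK.
have h : (fun k => \sum_i col i (Pmx k)) @ U --> \sum_i col i P'.
  by apply: cvg_sumr => i _; exact: cvg_col.
have e : (fun k => \sum_i col i (Pmx k)) @ U --> (0 : 'cV[R]_m).
  apply: (@eq_cvgl _ _ _ _ _ (cst 0)); last exact: cvg_cst.
  by move=> k; under eq_bigr do rewrite col_mx_of_cols; rewrite sum_p.
exact: cvg_unique h e.
Qed.

(** Along each ultrafilter [r] converges, so [locally_bounded] at its limit yields a bound there;
    [ultra_large_bound] makes the bound uniform. *)
Lemma local_argmin_bounded i : exists B, \forall k \near \oo,
  (argmin setT (local_obj (f i) (Q i) sigma rho (degree E i) (r k.+1 i))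
   `&` box B) !=set0.
Proof.
apply: ultra_large_bound => [B B' BB' k [w [wmin wB]]|U UU ooU].
  by exists w; split=> //; exact: le_trans wB BB'.
have [ys [P' [S' [YU _ [_ _ XU _]]]]] := ultra_limits U ooU.
pose rt := c i *: ys - col i (P' + S').
have rU : (fun k => r k.+1 i) @ U --> rt.
  have h : (fun k => c i *: col i (Ymx k) - col i (Xmx k)) @ U --> rt.
    apply: cvgB; last exact: cvg_col.
    apply: cvgZl_tmp; rewrite -[X in _ --> X](col_mx_of_cols (fun _ : 'I_N => ys) i).
    exact: cvg_col.
  apply: (eq_cvgl _ h) => k; rewrite !col_mx_of_cols (admm_y iterates).
  by rewrite scalerA divff ?gt_eqF ?c_gt0// scale1r addrC addKr.
have [Rad [B [Rad0 RB]]] := locally_bounded i rt.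
exists B; have Rad2 : 0 < Rad ^+ 2 by rewrite exprn_gt0.
have h : (fun k => mxdot (r k.+1 i - rt) (r k.+1 i - rt)) @ U --> (0 : R).
  rewrite -(mxdot0r (0 : 'cV[R]_m)) -(subrr rt).
  by apply: cvg_mxdot; apply: cvgB => //; exact: cvg_cst.
move/cvgr0Pnorm_lt : h => /(_ _ Rad2); apply: filterS => k /= le.
apply: RB; rewrite -(@ler_pXn2r _ 2)// ?nnegrE ?sqrtr_ge0 ?(ltW Rad0)//.
by rewrite sqr_enorm; apply/ltW; apply: le_lt_trans le; exact: ler_norm.
Qed.

Lemma local_obj_finite (i : 'I_N) k :
  exists w, (local_obj (f i) (Q i) sigma rho (degree E i) (r k.+1 i) w < +oo)%E.
Proof.
by have [w [a wa]] := Gamma_finite (f_Gamma i); exists w; rewrite /local_obj wa ltry.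
Qed.

(** From time [K] on, every bound of at least [B] passes the test, so doubling starts only below [B]
    and ends at most at [2 * B]. *)
Lemma x_bounded i : exists B, \forall k \near \oo, `|x k.+1 i| <= B.
Proof.
have [B [K _ KB]] := local_argmin_bounded i.
have Mpos k : 0 < M k i.
  elim: k => // k IH; have [t [-> _ _]] := admm_M iterates k i.
  by rewrite mulr_gt0// exprn_gt0.
pose C := Num.max (M K i) (2 * B).
have MC k : M (K + k)%N i <= C.
  elim: k => [|k IH]; first by rewrite addn0 le_max lexx.
  rewrite addnS; have [t [ME _ min]] := admm_M iterates (K + k)%N i.
  rewrite ME; case: t ME min => [|t] _ min; first by rewrite expr0 mul1r.
  rewrite le_max; apply/orP; right; rewrite exprS -mulrA ler_pM2l//.
  (* The bound before the last doubling was rejected, hence is at most [B]. *)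
  rewrite leNgt; apply/negP => /ltW BM; apply: (min t (ltnSn t)).
  apply: argmin_acceptable BM; first exact: local_obj_finite.
  exact/KB/leq_addr.
exists C, K => // k /= Kk; apply: le_trans (_ : M k.+1 i <= C).
  by have [] := admm_x iterates k i.
by have := MC (k.+1 - K)%N; rewrite subnKC// ltnW.
Qed.

(** By closedness of the subdifferentials the ultrafilter limit is itself a reference point. The
    Lyapunov function relative to it gives convergence of the whole of [y] and [z], while [x] is
    shown to converge only along [U]. *)
Lemma ultra_cluster (U : set_system nat) {UU : UltraFilter U} :
  \oo `<=` U -> exists (xs : forall i, 'cV[R]_(n i)) (ys : 'cV[R]_m),
  [/\ forall i, (fun k => x k.+1 i) @ U --> xs i,
      kkt f Q g xs ys, forall i, (fun k => y k i) @ \oo --> ys &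
      forall i, (fun k => z k i) @ \oo --> ys].
Proof.
move=> ooU; have [ys [P' [S' [YU ZU [PU SU XU P0]]]]] := ultra_limits U ooU.
have xlim i : {l : 'cV[R]_(n i) | (fun k => x k.+1 i) @ U --> l}.
  apply: cid; have [B xB] := x_bounded i.
  apply: (@ultra_bounded_cvg _ _ U UU _ _ (fun k => x k.+1 i) B) => a b.
  apply: ooU; apply: filterS xB => k; apply: le_trans.
  exact: ler_mxnorm_entry.
pose xs i := sval (xlim i).
have xsE i : (fun k => x k.+1 i) @ U --> xs i := svalP (xlim i).
have colU (u : nat -> 'I_N -> 'cV[R]_m) (L : 'M[R]_(m, N)) i :
    (fun k => mx_of_cols (u k)) @ U --> L -> (fun k => u k i) @ U --> col i L.
  move=> uL; apply: (eq_cvgl _ (cvg_col (j := i) uL)) => k.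
  by rewrite col_mx_of_cols.
have yU i : (fun k => y k.+1 i) @ U --> ys.
  by have := colU (fun k => y k.+1) _ i YU; rewrite col_mx_of_cols.
have zU i : (fun k => z k.+1 i) @ U --> ys.
  by have := colU (fun k => z k.+1) _ i ZU; rewrite col_mx_of_cols.
have sU i : (fun k => s k.+2 i) @ U --> col i S' := colU (fun k => s k.+2) _ i SU.
have QxU i : Q i *m xs i = col i P' + col i S'.
  rewrite -colD.
  have h : (fun k => Q i *m x k.+1 i) @ U --> col i (P' + S').
    exact: colU (fun k i => Q i *m x k.+1 i) _ i XU.
  have h' : (fun k => Q i *m x k.+1 i) @ U --> Q i *m xs i by exact: cvg_mulmx.
  exact: (cvg_unique _ h' h).
have ref : split_kkt xs ys (fun i => col i S').
  split=> [i|i|].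
  - apply: (subgradient_closed (f_Gamma i) _ (xsE i)).
      by apply: nearW => k; exact: primal_subgradient.
    by apply: cvgN; exact: cvg_mulmx.
  - apply: (subgradient_closed g_Gamma (x := fun k => N%:R *: s k.+2 i) _ _ (zU i)).
      by apply: nearW => k; exact: dual_subgradient.
    exact: cvgZl_tmp.
  - under eq_bigr do rewrite QxU.
    by rewrite big_split/= P0 add0r.
(* At this reference point [q0] is the limit of [p], since [Q i *m xs i] is the sum of the limits of
   [p] and [s]. *)
have PU' : Pmx @ U --> mx_of_cols (fun i => Q i *m xs i - col i S').
  suff -> : mx_of_cols (fun i => Q i *m xs i - col i S') = P' by exact: PU.
  by apply: eq_col => i; rewrite col_mx_of_cols QxU addrK.
have SU' : Smx @ U --> mx_of_cols (fun i => col i S').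
  suff -> : mx_of_cols (fun i => col i S') = S' by exact: SU.
  by apply: eq_col => i; rewrite col_mx_of_cols.
have [YE ZE] := ref_cvg xs ys (fun i => col i S') ref U ooU YU ZU PU' SU'.
have colE (u : nat -> 'I_N -> 'cV[R]_m) i :
    (fun k => mx_of_cols (u k.+1)) @ \oo --> mx_of_cols (fun _ : 'I_N => ys) ->
    (fun k => u k i) @ \oo --> ys.
  move=> uE; rewrite -(cvg_shiftS (fun k => u k i)).
  have h : (fun k => col i (mx_of_cols (u k.+1))) @ \oo --> ys.
    by rewrite -[X in _ --> X](col_mx_of_cols (fun _ : 'I_N => ys) i); exact: cvg_col.
  by apply: (eq_cvgl _ h) => k; rewrite col_mx_of_cols.
exists xs, ys; split; [exact: xsE|exact: split_kkt_kkt ref| |] => i.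
- exact: colE YE.
- exact: colE ZE.
Qed.

End admm.

Theorem theorem1 (R : realType) (N m : nat) (n : 'I_N -> nat)
  (f : forall i : 'I_N, 'cV[R]_(n i) -> \bar R)
  (Q : forall i : 'I_N, 'M[R]_(m, n i))
  (g : 'cV[R]_m -> \bar R) (E : rel 'I_N)
  (sigma rho : R)
  (p s r y z : nat -> 'I_N -> 'cV[R]_m)
  (x : nat -> forall i : 'I_N, 'cV[R]_(n i))
  (M : nat -> 'I_N -> R)
  (N_gt0 : (0 < N)%N)
  (g_Gamma : Gamma g)
  (f_Gamma : forall i, Gamma (f i))
  (primal_solution : exists x0, argmin setT (primal_obj f Q g) x0)
  (dual_solution : exists y0, argmax setT (dual_obj f Q g) y0)
  (strong_duality :
    min_value setT (primal_obj f Q g) = max_value setT (dual_obj f Q g))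
  (E_connected : connected_graph E)
  (E_undirected : undirected E)
  (sigma_gt0 : 0 < sigma) (rho_gt0 : 0 < rho)
  (p0 : forall i, p 0%N i = 0)
  (M_gt0 : forall i, 0 < M 0%N i)
  (iterates : dual_consensus_admm f Q g E sigma rho p s r y z x M)
  (locally_bounded : forall (i : 'I_N) (rt : 'cV[R]_m),
    exists Rad Mbar : R, 0 < Rad /\
      forall k : nat, enorm (r k.+1 i - rt) <= Rad ->
        (argmin setT
           (local_obj (f i) (Q i) sigma rho (degree E i) (r k.+1 i))
         `&` box Mbar) !=set0) :
  (exists ystar : 'cV[R]_m,
     [/\ argmax setT (dual_obj f Q g) ystar,
         (forall i, (fun k => y k i) @ \oo --> ystar) &
         (forall i, (fun k => z k i) @ \oo --> ystar)]) /\
  cvg_to_set (fun k => to_opc (stack (x k)))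
    [set to_opc (stack x') | x' in argmin setT (primal_obj f Q g)].
Proof.
have [x0 x0min] := primal_solution; have [y0 y0max] := dual_solution.
have gap0 : dual_obj f Q g y0 = primal_obj f Q g x0.
  by rewrite -(min_value_argmin x0min) strong_duality (max_value_argmax y0max).
have ref_exists : exists xs ys ss, split_kkt R N m n f Q g xs ys ss.
  exists x0, y0, (fun=> N%:R^-1 *: \sum_i Q i *m x0 i).
  by apply: kkt_split_kkt => //; exact: optimal_kkt gap0.
have cluster U (UU : UltraFilter U) : \oo `<=` U ->
    exists (xs : forall i, 'cV[R]_(n i)) (ys : 'cV[R]_m),
    [/\ forall i, (fun k => x k.+1 i) @ U --> xs i,
        kkt f Q g xs ys, forall i, (fun k => y k i) @ \oo --> ys &
        forall i, (fun k => z k i) @ \oo --> ys].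
  exact: (ultra_cluster R N m n f Q g E sigma rho p s r y z x M N_gt0 g_Gamma
    f_Gamma E_connected E_undirected sigma_gt0 rho_gt0 p0 M_gt0 iterates
    ref_exists locally_bounded U).
split.
  have [U [UU ooU]] := ultraFilterLemma (_ : ProperFilter \oo).
  have [xs [ys [_ opt YE ZE]]] := cluster U UU ooU.
  exists ys; split=> [|i|i]; [|exact: YE|exact: ZE].
  (* The dual value at [ys] is the primal value at [xs], hence at least the common optimal value. *)
  split=> // w _; rewrite (kkt_dual_obj N_gt0 f_Gamma g_Gamma opt).
  apply: le_trans (proj2 y0max w I) _; rewrite gap0.
  exact: (proj2 x0min).
move=> V oV SV; apply: contrapT => nV.
(* If [x] left [V] infinitely often, some ultrafilter would live on those times; along it [x] tends
   to a minimiser, which lies in the open [V]. *)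
pose D K := [set k | (K <= k)%N /\ ~ V (to_opc (stack (x k.+1)))].
have FD : ProperFilter (filter_from setT D).
  apply: filter_from_proper.
    apply: filter_from_filter; first by exists 0%N.
    move=> K K' _ _; exists (maxn K K') => // k [].
    by rewrite geq_max => /andP[Kk K'k] nk; split; split.
  move=> K _; apply: contrapT => D0; apply: nV; exists K.+1 => // -[//|k] /= Kk.
  by apply: contrapT => nVk; apply: D0; exists k.
have [U [UU FU]] := ultraFilterLemma FD.
have ooU : \oo `<=` U.
  by move=> C [K _ KC]; apply: FU; exists K => // k [Kk _]; exact: KC.
have [xs [ys [xU opt _ _]]] := cluster U UU ooU.
have stackU : (fun k => stack (x k.+1)) @ U --> stack xs.
  apply/mx_cvgP => a b; rewrite /stack mxE.
  under eq_fun do rewrite mxE.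
  by have /mx_cvgP := xU (tagnat.sig1 a); apply.
have Vxs : V (to_opc (stack xs)).
  by apply: SV; exists xs => //; exact: kkt_argmin opt.
have UV : U [set k | V (to_opc (stack (x k.+1)))].
  (* At a finite point the compactification has the neighbourhoods of the original space, so
     convergence of the stacked vectors suffices. *)
  exact: (stackU [set w | V (to_opc w)] (open_nbhs_nbhs (conj oV Vxs))).
have UnV : U [set k | ~ V (to_opc (stack (x k.+1)))].
  by apply: FU; exists 0%N => // k [].
by have [k []] := filter_ex (filterI UV UnV).
Qed.
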